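(* Let $\Gamma$ be any compact Dirichlet tree. Then, for any integer $k\ge 1$, $$\frac{\lambda_{2k}(\Gamma)}{\lambda_k(\Gamma)}\le 4.$$
   Context: A compact metric graph $\Gamma=(\mathcal V,\mathcal E)$ has finitely many vertices and edges; each edge $e$ is identified with an interval $[0,\ell_e]$, $0<\ell_e<\infty$, whose endpoints are attached to vertices; $\Gamma$ is connected. It is a tree if $|\mathcal E|-|\mathcal V|+1=0$. A leaf is a vertex of degree one. $C(\Gamma)$ denotes the continuous functions on $\Gamma$ and $H^1(\Gamma)=\{f\in C(\Gamma): f|_e\in H^1(e)\ \forall e\in\mathcal E\}$. A compact Dirichlet tree is a compact tree $\Gamma$ equipped with the Laplacian $-\Delta$ (acting as $-f''$ on each edge) with a Dirichlet (zero) condition at every leaf and, at every other vertex, the Kirchhoff condition (continuity, and the sum of the derivatives along all incident edges, all oriented into the vertex, is zero). Equivalently, $-\Delta$ is the self-adjoint operator on $L^2(\Gamma)$ associated with the form $\int_\Gamma f'\overline{g}'\,dx$ on the set of $f\in H^1(\Gamma)$ vanishing at all leaves. Its eigenvalues, counted with multiplicity, are $0<\lambda_1(\Gamma)<\lambda_2(\Gamma)\le\lambda_3(\Gamma)\le\dots$. *)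

(* Defs.v *)
From HB Require Import structures.
From mathcomp Require Import all_boot all_order all_algebra.
From mathcomp Require Import complex.
From mathcomp Require Import all_classical all_reals all_analysis.

Set Implicit Arguments.
Unset Strict Implicit.
Unset Printing Implicit Defensive.

Import Order.TTheory GRing.Theory Num.Theory.
Import numFieldNormedType.Exports.

Local Open Scope card_scope.
Local Open Scope classical_set_scope.
Local Open Scope ring_scope.
Local Open Scope complex_scope.

(* Edge e is the interval [0, len e], its point 0 being attached to [src e]
   and its point [len e] to [tgt e].  The orientation is only a choice of
   parametrization.  Loops and multiple edges are allowed. *)
Record metric_graph (R : realType) := MetricGraph {
  vertex : finType;
  edge : finType;
  src : edge -> vertex;
  tgt : edge -> vertex;
  len : edge -> R;
  len_gt0 : forall e, 0 < len e;
  graph_connected : forall u v : vertex,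
    connect [rel a b | [exists e, ((src e == a) && (tgt e == b))
                               || ((src e == b) && (tgt e == a))]] u v
}.

Definition is_tree (R : realType) (G : metric_graph R) : Prop :=
  #|edge G|%:Z - #|vertex G|%:Z + 1 = 0 :> int.

(* A loop contributes two to the degree. *)
Definition degree (R : realType) (G : metric_graph R) (v : vertex G) : nat :=
  (#|[pred e : edge G | src e == v]| + #|[pred e : edge G | tgt e == v]|)%N.

Definition leaf (R : realType) (G : metric_graph R) (v : vertex G) : bool :=
  degree v == 1%N.

(* Functions on the metric graph, given edge by edge.  Only the values [f e x]
   with x in [0, len e] are meaningful; see [eq_on_graph]. *)
Definition graph_fun (R : realType) (G : metric_graph R) : Type :=
  edge G -> R -> R[i].

Definition eq_on_graph (R : realType) (G : metric_graph R)
    (f g : graph_fun G) : Prop :=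
  forall (e : edge G) (x : R), x \in `[0, len e] -> f e x = g e x.

Definition square_integrable (R : realType) (l : R) (u : R -> R) : Prop :=
  measurable_fun `[0, l] u /\
  lebesgue_measure.-integrable `[0, l] (fun x => (u x ^+ 2)%:E).

(* u is the continuous representative of an element of the real space
   H^1(0, l), and v is a representative of its weak derivative in L^2(0, l). *)
Definition H1_deriv_real (R : realType) (l : R) (u v : R -> R) : Prop :=
  square_integrable l v /\
  forall x, x \in `[0, l] ->
    u x = u 0 + \int[lebesgue_measure]_(t in `[0, x]) v t.

Definition H1_deriv (R : realType) (l : R) (u v : R -> R[i]) : Prop :=
  H1_deriv_real l (fun x => complex.Re (u x)) (fun x => complex.Re (v x)) /\
  H1_deriv_real l (fun x => complex.Im (u x)) (fun x => complex.Im (v x)).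

Definition continuous_at_vertices (R : realType) (G : metric_graph R)
    (f : graph_fun G) (val : vertex G -> R[i]) : Prop :=
  forall e : edge G, f e 0 = val (src e) /\ f e (len e) = val (tgt e).

(* [p e] is the derivative along the edge e in its parametrization, so the
   derivative oriented into the vertex is [p e (len e)] at [tgt e] and
   [- p e 0] at [src e]. *)
Definition kirchhoff_at (R : realType) (G : metric_graph R)
    (p : graph_fun G) (v : vertex G) : Prop :=
  \sum_(e : edge G | tgt e == v) p e (len e)
    + \sum_(e : edge G | src e == v) - p e 0 = 0.

(* Graph of the operator: f is in the domain and - Delta f = g in L^2.  The
   second condition forces each [p e] to be the continuous representative of
   the derivative of [f e], so that its endpoint values make sense. *)
Definition dirichlet_laplacian (R : realType) (G : metric_graph R)
    (f g : graph_fun G) : Prop :=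
  exists (p : graph_fun G) (val : vertex G -> R[i]),
    [/\ forall e, H1_deriv (len e) (f e) (p e),
        forall e, H1_deriv (len e) (p e) (fun x => - g e x),
        continuous_at_vertices f val,
        forall v, leaf v -> val v = 0
      & forall v, ~~ leaf v -> kirchhoff_at p v].

Definition eigenspace_at (R : realType) (G : metric_graph R) (mu : R) :
    set (graph_fun G) :=
  [set f | dirichlet_laplacian f (fun e x => mu%:C * f e x)].

Definition lin_comb (R : realType) (G : metric_graph R) (n : nat)
    (c : 'I_n -> R[i]) (b : 'I_n -> graph_fun G) : graph_fun G :=
  fun e x => \sum_(i < n) c i * b i e x.

(* S, up to equality on the graph, is a complex vector space of dimension n. *)
Definition has_dimension (R : realType) (G : metric_graph R)
    (S : set (graph_fun G)) (n : nat) : Prop :=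
  exists b : 'I_n -> graph_fun G,
    [/\ forall i, S (b i),
        forall c : 'I_n -> R[i],
          eq_on_graph (lin_comb c b) (fun _ _ => 0) -> forall i, c i = 0
      & forall f, S f -> exists c : 'I_n -> R[i], eq_on_graph f (lin_comb c b)].

(* lam 1 <= lam 2 <= ... lists the eigenvalues with multiplicity; the value
   lam 0 is not used. *)
Definition is_dirichlet_spectrum (R : realType) (G : metric_graph R)
    (lam : nat -> R) : Prop :=
  (forall j k : nat, (1 <= j <= k)%N -> lam j <= lam k) /\
  (forall mu : R, exists n : nat,
     has_dimension (@eigenspace_at R G mu) n /\
     [set k : nat | (1 <= k)%N /\ lam k = mu] #= `I_n).

(* Main.v *)
(** Root the tree at a leaf.  A branch hanging at a vertex carries, at frequency
    s, a Pruefer phase: a solution of -f'' = s^2 f satisfying all conditions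
    inside the branch is a multiple of cos (x + s t) along the edge that leaves
    the branch.  In these terms a Dirichlet leaf has phase -pi/2, an edge of
    length l adds s l, and the Kirchhoff condition adds the tangents of the
    phases of the branches joined at a vertex, where multiples of pi are counted
    so that the phase is nondecreasing in s.  When branches vanish
    simultaneously at the vertex the phase jumps by a multiple of pi, and the
    multiple is the number of eigenfunctions so created.  Hence the phase of the
    whole tree, counted from -pi/2 in units of pi, is the number N(s) of
    eigenvalues at most s^2.

    Measured from the Dirichlet condition, the phase T of every branch satisfies
    T(2s) >= 2 T(s): this is clear for a leaf, is preserved when an edge is
    added, and is preserved at a vertex by an elementary inequality between
    tangents of double angles.  Therefore N(2s) >= 2 N(s), which is the claim. *)

Require Import Defs.
From HB Require Import structures.
From mathcomp Require Import all_boot all_order all_algebra.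
From mathcomp Require Import complex.
From mathcomp Require Import all_classical all_reals all_analysis.
From mathcomp Require Import measurable_realfun.
From mathcomp Require Import ring lra zify.

Set Implicit Arguments.
Unset Strict Implicit.
Unset Printing Implicit Defensive.

Import Order.TTheory GRing.Theory Num.Theory.
Import numFieldNormedType.Exports.

Local Open Scope classical_set_scope.
Local Open Scope complex_scope.
Local Open Scope ring_scope.

(** * Merging phases *)

Section Merge.
Context {R : realType}.
Implicit Types (x y a b c e : R) (n m : int).

Local Notation h := (pi / 2 : R).

(** The spectrum is given only as a sequence whose level sets have the size of the eigenspaces, so
    the claim about N rests on jumps: such a sequence is recovered from N(0) = 0 and the jumps of N,
    provided N is right continuous with left limits and each jump is the dimension of an eigenspace.
    The left limit of the phase is therefore carried along the tree as well. It obeys the same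
    recursion with [merge_lower], the conjugate of [merge] by x -> -x, and differs from the phase by
    [pi] times the number of collisions. The same number is found by linear algebra, when pendant
    edges are eliminated from the equations of an eigenfunction. There the state at a vertex is kept
    as a multiple of (cos t, - sin t) instead of a quotient, so that vanishing at a vertex is not a
    singular case. *)

Lemma pihalf_gt0 : 0 < h.
Proof. by rewrite divr_gt0 // pi_gt0. Qed.

Lemma piE : pi = h + h :> R.
Proof. by field. Qed.

Lemma tan_lt a b : - h < a -> a < b -> b < h -> tan a < tan b.
Proof. by move=> ha ab bh; rewrite ltr_tan // in_itv /=; apply/andP; split; lra. Qed.

Lemma tan_le a b : - h < a -> a <= b -> b < h -> tan a <= tan b.
Proof.
move=> ha; rewrite le_eqVlt => /predU1P[-> //|ab] bh.
by rewrite ltW // tan_lt.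
Qed.

Lemma atan_tan a : - h < a -> a < h -> atan (tan a) = a.
Proof. by move=> ha ah; rewrite tanK // in_itv /= ha ah. Qed.

(* [x = turns x * pi + residue x] with [residue x] in [-pi/2, pi/2[. *)
Definition turns x : int := Num.floor (x / pi + 2^-1).

Definition residue x : R := x - (turns x)%:~R * pi.

(* A branch of phase [x] arrives at a vertex as a multiple of [cos (x + s t)]:
   its flux is [- tan x] times its value, so joining branches adds tangents.
   At [- pi / 2], where the tangent is infinite, the value is 0. *)
Definition merge0 a b : R :=
  if (a == - h) || (b == - h) then - h else atan (tan a + tan b).

(** Lift of the addition of tangents from directions to the line, equivariant under turns in each
    argument: the turns are what will count eigenvalues. [locked] stops simplification from
    unfolding it. *)
Definition merge x y : R :=
  locked ((turns x + turns y)%:~R * pi + merge0 (residue x) (residue y)).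

Lemma turns_spec x : exists n a, [/\ - h <= a, a < h & x = n%:~R * pi + a].
Proof.
exists (turns x), (residue x); rewrite /residue.
have p0 := pi_gt0 R.
have /andP[l1 l2] := floor_itv (x / pi + 2^-1).
rewrite -/(turns x) in l1 l2.
have ex : x = x / pi * pi by rewrite divfK // gt_eqF.
move: (x / pi) l1 l2 ex => q l1 l2 ex; rewrite intrD in l2.
split; last by lra.
- have : ((turns x)%:~R - 2^-1) * pi <= q * pi by rewrite ler_pM2r //; lra.
  by lra.
- have : q * pi < ((turns x)%:~R + 2^-1) * pi by rewrite ltr_pM2r //; lra.
  by lra.
Qed.

Lemma turnsE n a : - h <= a -> a < h -> turns (n%:~R * pi + a) = n.
Proof.
move=> ha ah; apply: floor_def.
have p0 := pi_gt0 R; have e1 : (n%:~R * pi + a) / pi = n%:~R + a / pi.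
  by rewrite mulrDl mulfK // gt_eqF.
have ea : a = a / pi * pi by rewrite divfK // gt_eqF.
rewrite e1 intrD; move: (a / pi) ea => q ea.
have : - 2^-1 * pi <= q * pi by lra.
rewrite ler_pM2r // => q1.
have : q * pi < 2^-1 * pi by lra.
rewrite ltr_pM2r // => q2.
by apply/andP; split; lra.
Qed.

Lemma mergeE n m a b : - h <= a -> a < h -> - h <= b -> b < h ->
  merge (n%:~R * pi + a) (m%:~R * pi + b) = (n + m)%:~R * pi + merge0 a b.
Proof.
move=> ha ah hb bh; rewrite /merge -lock /residue !turnsE //.
by rewrite ![_ * pi + _ - _]addrC !addKr.
Qed.

Lemma mergeE0 a b : - h <= a -> a < h -> - h <= b -> b < h ->
  merge a b = merge0 a b.
Proof.
by move=> *; have := @mergeE 0 0 a b; rewrite addr0 mul0r !add0r; apply.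
Qed.

Lemma mergeC x y : merge x y = merge y x.
Proof. by rewrite /merge -!lock /merge0 orbC [turns x + _]addrC [tan _ + _]addrC. Qed.

Lemma turnD n m a : n%:~R * pi + (m%:~R * pi + a) = (n + m)%:~R * pi + a.
Proof. by rewrite intrD mulrDl addrA. Qed.

Lemma merge_turn n m x y :
  merge (n%:~R * pi + x) (m%:~R * pi + y) = (n + m)%:~R * pi + merge x y.
Proof.
have [k [a [ha ah ->]]] := turns_spec x; have [l [b [hb bh ->]]] := turns_spec y.
by rewrite (mergeE k l) // !turnD mergeE // addrACA.
Qed.

Lemma merge0_itv a b : - h <= merge0 a b /\ merge0 a b < h.
Proof.
have p0 := pihalf_gt0; rewrite /merge0; case: ifP => _; first by split; lra.
by split; [exact/ltW/atan_gtNpi2 | exact: atan_ltpi2].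
Qed.

Lemma merge0_edge b : merge0 (- h) b = - h.
Proof. by rewrite /merge0 eqxx. Qed.

Lemma merge0_in a b : - h < a -> - h < b -> merge0 a b = atan (tan a + tan b).
Proof. by move=> ha hb; rewrite /merge0 !gt_eqF. Qed.

Lemma merge0_le a b a' b' : - h <= a -> a <= a' -> a' < h ->
  - h <= b -> b <= b' -> b' < h -> merge0 a b <= merge0 a' b'.
Proof.
rewrite le_eqVlt => /predU1P[<-|ha] aa ah.
  by rewrite merge0_edge => *; have [] := merge0_itv a' b'.
rewrite le_eqVlt => /predU1P[<-|hb] bb bh.
  by rewrite {1}/merge0 eqxx orbT; have [] := merge0_itv a' b'.
rewrite !merge0_in ?(lt_le_trans ha aa) ?(lt_le_trans hb bb) //.
by rewrite le_atan // lerD // tan_le.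
Qed.

(** Within one turn this is monotonicity of the tangent. Between different turns it holds whatever
    the residues are, because [merge0] takes its values in a single period. *)
Lemma le_mergel x x' y : x <= x' -> merge x y <= merge x' y.
Proof.
have [n [a [ha ah ->]]] := turns_spec x; have [n' [a' [ha' ah' ->]]] := turns_spec x'.
have [m [b [hb bh ->]]] := turns_spec y.
move=> xx; have p0 := pi_gt0 R.
have [nn|nn|nn] := ltgtP n n'.
- rewrite !mergeE // !intrD.
  have [c1 c2] := merge0_itv a b; have [d1 d2] := merge0_itv a' b.
  have : (n + 1)%:~R <= n'%:~R :> R by rewrite ler_int lezD1.
  rewrite -(ler_pM2r p0) intrD.
  by move: (merge0 _ _) (merge0 _ _) c1 c2 d1 d2 => c d; lra.
- have : (n' + 1)%:~R <= n%:~R :> R by rewrite ler_int lezD1.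
  by rewrite -(ler_pM2r p0) intrD; lra.
- rewrite nn lerD2l in xx.
  by rewrite nn !mergeE // lerD2l merge0_le.
Qed.

Lemma le_merge x x' y y' : x <= x' -> y <= y' -> merge x y <= merge x' y'.
Proof.
move=> xx yy; apply: le_trans (le_mergel y xx) _.
by rewrite ![merge x' _]mergeC le_mergel.
Qed.

(** A vertex that no branch has reached has zero flux, hence phase 0; its first branch then passes
    its phase on unchanged. *)
Lemma merge0x x : merge 0 x = x.
Proof.
have [n [a [ha ah ->]]] := turns_spec x; have p0 := pihalf_gt0.
have := @merge_turn 0 n 0 a; rewrite mul0r !add0r => ->.
rewrite mergeE0 ?oppr_le0 //; [|exact: ltW..].
congr (_ + _); move: ha; rewrite le_eqVlt => /predU1P[<-|ha].
  by rewrite /merge0 eqxx orbT.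
by rewrite merge0_in ?oppr_lt0 // tan0 add0r atan_tan.
Qed.

(** The Dirichlet phase is absorbing up to turns: a branch that must vanish at the vertex forces the
    joined solution to vanish there. *)
Lemma merge_edge y : exists n, merge (- h) y = n%:~R * pi - h.
Proof.
have [n [a [ha ah ->]]] := turns_spec y; have p0 := pihalf_gt0; exists n.
have := @merge_turn 0 n (- h) a; rewrite mul0r !add0r => ->.
by rewrite mergeE0 ?merge0_edge //; lra.
Qed.

Lemma merge_edge2 : merge (- h) (- h) = - h.
Proof. by have p0 := pihalf_gt0; rewrite mergeE0 ?merge0_edge //; lra. Qed.

Lemma sin_turn n : sin (n%:~R * pi : R) = 0.
Proof.
have sin_nat k : sin (k%:R * pi : R) = 0.
  by rewrite mulr_natl -[pi *+ k]add0r (alternatingn (@sinDpi R)) sin0 mulr0.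
by case: n => k; rewrite ?NegzE ?mulrNz ?mulNr ?sinN -pmulrn sin_nat ?oppr0.
Qed.

Lemma cos_turn_neq0 n : cos (n%:~R * pi : R) != 0.
Proof.
have := cos2Dsin2 (n%:~R * pi : R); rewrite sin_turn expr0n addr0 => c1.
by apply/negP => /eqP c0; move: c1; rewrite c0 expr0n => /eqP; rewrite eq_sym oner_eq0.
Qed.

Lemma sinD_turn n a : sin (n%:~R * pi + a) = cos (n%:~R * pi) * sin a.
Proof. by rewrite sinD sin_turn mul0r add0r. Qed.

Lemma cosD_turn n a : cos (n%:~R * pi + a) = cos (n%:~R * pi) * cos a.
Proof. by rewrite cosD sin_turn mul0r subr0. Qed.

Lemma sin_edge : sin (- h) = -1.
Proof. by rewrite sinN sin_pihalf. Qed.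

Lemma cos_edge : cos (- h) = 0.
Proof. by rewrite cosN cos_pihalf. Qed.

Lemma cos_base_eq0 a : - h <= a -> a < h -> (cos a == 0) = (a == - h).
Proof.
rewrite le_eqVlt => /predU1P[<-|ha] ah; first by rewrite cos_edge !eqxx.
by rewrite !gt_eqF // cos_gt0_pihalf // ha ah.
Qed.

(* Both sides say that the directions (cos (merge x y), sin (merge x y)) and
   (cos x cos y, sin (x + y)) are parallel, the second one being the sum of the
   fluxes of two branches scaled to have a common value. *)
Lemma merge_dir x y :
  cos (merge x y) * sin (x + y) = sin (merge x y) * (cos x * cos y).
Proof.
have [n [a [ha ah ->]]] := turns_spec x; have [m [b [hb bh ->]]] := turns_spec y.
rewrite mergeE // addrACA -mulrDl -intrD !sinD_turn !cosD_turn.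
have cnm : cos ((n + m)%:~R * pi : R) = cos (n%:~R * pi) * cos (m%:~R * pi).
  by rewrite intrD mulrDl cosD_turn.
suff e0 : cos (merge0 a b) * sin (a + b) = sin (merge0 a b) * (cos a * cos b).
  by rewrite cnm; transitivity ((cos (n%:~R * pi) * cos (m%:~R * pi)) ^+ 2 *
    (cos (merge0 a b) * sin (a + b))); [ring | rewrite e0; ring].
move: ha; rewrite le_eqVlt => /predU1P[<-|ha].
  by rewrite merge0_edge cos_edge !mul0r mulr0.
move: hb; rewrite le_eqVlt => /predU1P[<-|hb].
  by rewrite /merge0 eqxx orbT cos_edge !mul0r !mulr0.
rewrite merge0_in //; set t := tan a + tan b.
have ca : cos a != 0 by rewrite cos_base_eq0 ?gt_eqF // ltW.
have cb : cos b != 0 by rewrite cos_base_eq0 ?gt_eqF // ltW.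
have ct : cos (atan t) != 0.
  by rewrite cos_base_eq0 ?atan_ltpi2 ?gt_eqF ?ltW // atan_gtNpi2.
have <- : tan (atan t) * cos (atan t) = sin (atan t) by rewrite divfK.
by rewrite atanK sinD /t /tan; field; rewrite ca cb.
Qed.

(* The limit of [merge] from below. *)
Definition merge_lower x y : R := - merge (- x) (- y).

(** Reflection turns [[-pi/2, pi/2[] into []-pi/2, pi/2]], so only residues [- pi / 2] change their
    turn. One such residue is compensated by the two values [- pi / 2] of [merge0]; two of them
    leave an excess of [pi]. *)
Lemma mergeN x y :
  merge x y + merge (- x) (- y) = ((cos x == 0) && (cos y == 0))%:R * pi.
Proof.
have [n [a [ha ah ->]]] := turns_spec x; have [m [b [hb bh ->]]] := turns_spec y.
rewrite !cosD_turn !mulf_eq0 !(negPf (cos_turn_neq0 _)) /= !cos_base_eq0 //.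
have oppT k z : - (k%:~R * pi + z) = (- k)%:~R * pi - z by rewrite opprD mulrNz mulNr.
rewrite mergeE // !oppT; have p0 := pihalf_gt0.
have edge k : (- k)%:~R * pi - (- h) = (1 - k)%:~R * pi + (- h).
  by rewrite intrD mulr1z; lra.
move: ha; rewrite le_eqVlt => /predU1P[<-|ha];
  move: hb; rewrite le_eqVlt => /predU1P[<-|hb].
- rewrite !edge mergeE ?merge0_edge ?eqxx /= ?mul1r // ?intrD ?mulrNz ?mulr1z; lra.
- rewrite edge mergeE ?merge0_edge ?eqxx ?(gt_eqF hb) /= ?mul0r // ?intrD ?mulrNz ?mulr1z; lra.
- rewrite edge mergeE ?eqxx ?(gt_eqF ha) /= ?mul0r //; try lra.
  rewrite /merge0 eqxx !orbT.
  by rewrite !intrD ?mulrNz ?mulr1z; lra.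
- rewrite mergeE ?(gt_eqF ha) ?mul0r //; try lra.
  rewrite !merge0_in // ?ltrN2 // !tanN.
  have -> : atan (- tan a - tan b) = - atan (tan a + tan b) by rewrite -atanN opprD.
  by rewrite !intrD !mulrNz; lra.
Qed.

(** At an intermediate [z] with [cos z] nonzero, [merge] and [merge_lower] agree, and both are
    monotone. Strictness is asked of one argument only: the phase already present at a vertex may be
    constant in the frequency, while that of a branch ending in an edge increases strictly. *)
Lemma merge_ltl x x' y y' : x' <= x -> y' < y -> merge x' y' <= merge_lower x y.
Proof.
move=> xx yy; have p0 := pihalf_gt0.
have [z [z1 z2 cz]] : exists z, [/\ y' <= z, z <= y & cos z != 0].
  have [c0|] := eqVneq (cos y') 0; last by exists y'; rewrite lexx ltW.
  (* From a zero of [cos], a shift by at most [pi / 2] leaves the zero without reaching the next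
     one. *)
  pose d := Num.min (y - y') h.
  have d0 : 0 < d by rewrite lt_min subr_gt0 yy p0.
  exists (y' + d); split; [lra| |].
    by rewrite -lerBrDl ge_min lexx.
  have s0 : sin y' != 0.
    apply/negP => /eqP s0; have := cos2Dsin2 y'.
    by rewrite c0 s0 expr0n addr0 => /eqP; rewrite eq_sym oner_eq0.
  rewrite cosD c0 mul0r sub0r oppr_eq0 mulf_neq0 // gt_eqF // sin_gt0_pi //.
  have : d <= h by rewrite ge_min lexx orbT.
  by rewrite d0 piE /=; lra.
apply: (@le_trans _ _ (merge x' z)); first exact: le_merge.
have := mergeN x' z; rewrite (negPf cz) andbF mul0r => /eqP.
by rewrite addr_eq0 => /eqP ->; rewrite lerN2 le_merge // lerN2.
Qed.

Lemma merge0_right a b e : - h <= a -> a < h -> - h <= b -> b < h -> 0 < e ->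
  exists a' b', [/\ a < a', a' < h, b < b', b' < h & merge0 a' b' < merge0 a b + e].
Proof.
wlog ab : a b / ((a == - h) || (b == - h)) ==> (a == - h).
  move=> W; have [/eqP aE|na] := boolP (a == - h); first by apply: W; rewrite aE eqxx implybT.
  have [/eqP bE|nb] := boolP (b == - h); last by apply: W; rewrite (negPf na) (negPf nb).
  move=> ha ah hb bh e0; have W1 : (b == - h) || (a == - h) ==> (b == - h).
    by rewrite bE eqxx.
  have [b' [a' [? ? ? ? m1]]] := W b a W1 hb bh ha ah e0.
  exists a', b'; split => //; move: m1.
  by rewrite /merge0 orbC [tan a' + _]addrC [(a == _) || _]orbC [tan a + _]addrC.
move=> ha ah hb bh e0; have p0 := pihalf_gt0.
have [c1 c2] := merge0_itv a b.
have [f [f1 f2 fe]] : exists f, [/\ merge0 a b < f, f < h & f <= merge0 a b + e].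
  exists (Num.min (merge0 a b + e) ((merge0 a b + h) / 2)).
  split; last by rewrite ge_min lexx.
    by rewrite lt_min; apply/andP; split; lra.
  by rewrite gt_min; apply/orP; right; lra.
have hf : - h < f by exact: le_lt_trans f1.
have [aE|na] := eqVneq a (- h).
  (* [a'] is chosen to make [tan a' + tan b'] equal to [tan f - 1]: close to [- pi / 2] the tangent
     is negative enough to offset any [tan b']. *)
  pose b' := (b + h) / 2.
  exists (atan (tan f - tan b' - 1)), b'.
  rewrite aE in fe *; rewrite atan_gtNpi2 atan_ltpi2; split => //; rewrite /b'; try lra.
  apply: (lt_le_trans _ fe); rewrite merge0_in ?atan_gtNpi2 //; last by lra.
  rewrite atanK -[X in _ < X](atan_tan hf f2) lt_atan //; lra.
have nb : b != - h by move: ab; rewrite (negPf na) /= implybF.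
have {na}ha : - h < a by rewrite lt_neqAle eq_sym na.
have {nb}hb : - h < b by rewrite lt_neqAle eq_sym nb.
have f1' : atan (tan a + tan b) < f by rewrite -merge0_in.
have : tan a + tan b < tan f.
  by rewrite -[tan a + _]atanK tan_lt // atan_gtNpi2.
(* A third of the gap for each argument, so that the two shares together stay strictly below
   [tan f]. *)
move=> gap; pose g := (tan f - (tan a + tan b)) / 3.
exists (atan (tan a + g)), (atan (tan b + g)); rewrite !atan_ltpi2; split => //.
- by rewrite -[X in X < _](atan_tan ha ah) lt_atan // /g; lra.
- by rewrite -[X in X < _](atan_tan hb bh) lt_atan // /g; lra.
- apply: (lt_le_trans _ fe); rewrite merge0_in ?atan_gtNpi2 // !atanK.
  by rewrite -[X in _ < X](atan_tan hf f2) lt_atan // /g; lra.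
Qed.

Lemma merge_right x y e : 0 < e ->
  exists2 d, 0 < d & merge (x + d) (y + d) < merge x y + e.
Proof.
have [n [a [ha ah ->]]] := turns_spec x; have [m [b [hb bh ->]]] := turns_spec y.
move=> e0; have [a' [b' [a1 a2 b1 b2 lt]]] := merge0_right ha ah hb bh e0.
exists (Num.min (a' - a) (b' - b)); first by rewrite lt_min !subr_gt0 a1 b1.
set d := Num.min _ _.
have da : a + d <= a' by rewrite -lerBrDl ge_min lexx.
have db : b + d <= b' by rewrite -lerBrDl ge_min lexx orbT.
rewrite -!addrA; apply: (@le_lt_trans _ _ (merge (n%:~R * pi + a') (m%:~R * pi + b'))).
  by rewrite le_merge // lerD2l.
by rewrite !mergeE //; lra.
Qed.

Lemma merge_lower_le x x' y y' : x <= x' -> y <= y' ->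
  merge_lower x y <= merge_lower x' y'.
Proof. by move=> xx yy; rewrite lerN2 le_merge // lerN2. Qed.

Lemma merge_lowerE x y :
  merge_lower x y = merge x y - ((cos x == 0) && (cos y == 0))%:R * pi.
Proof. by rewrite -mergeN /merge_lower; ring. Qed.

Lemma merge_lower_turn n m x y :
  merge_lower (x - n%:~R * pi) (y - m%:~R * pi) = merge_lower x y - (n + m)%:~R * pi.
Proof.
have oppT (k : int) z : - (z - k%:~R * pi) = k%:~R * pi - z by rewrite opprB.
by rewrite /merge_lower !oppT merge_turn opprD addrC.
Qed.

Lemma merge_left x y e : 0 < e ->
  exists2 d, 0 < d & merge_lower x y - e < merge_lower (x - d) (y - d).
Proof.
move=> e0; have [d d0 lt] := merge_right (- x) (- y) e0; exists d => //.
by rewrite /merge_lower !opprB ![d - _]addrC; lra.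
Qed.

Lemma cos_merge_eq0 x y : cos x = 0 -> cos (merge x y) = 0.
Proof.
have [n [a [ha ah ->]]] := turns_spec x; move=> /eqP.
rewrite cosD_turn mulf_eq0 (negPf (cos_turn_neq0 _)) /= cos_base_eq0 // => /eqP ->.
have := @merge_turn n 0 (- h) y; rewrite mul0r add0r => ->.
have [k ->] := merge_edge y.
by rewrite turnD cosD_turn cos_edge mulr0.
Qed.

(** For phases counted from [- pi / 2], doubling sends [a + pi / 2] to [2 (a + pi / 2)], that is [a]
    to [2 a + pi / 2]; the tangent there is minus the cotangent of [2 a]. *)
Lemma tan_double a : cos a != 0 -> sin a != 0 ->
  tan (2 * a + h) = (tan a - (tan a)^-1) / 2.
Proof.
move=> ca sa; have e2 : 2 * a = a + a by ring.
rewrite /tan sinDpihalf cosDpihalf e2 sinD cosD.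
field; rewrite ca sa /= [cos a * sin a]mulrC -mulr2n -mulr_natr.
by rewrite !mulf_neq0 // pnatr_eq0.
Qed.

Lemma double_turn n a : 2 * (n%:~R * pi + a) + h = (n + n)%:~R * pi + (2 * a + h).
Proof. by rewrite intrD; ring. Qed.

Lemma tan_gt0_pihalf a : 0 < a -> a < h -> 0 < tan a.
Proof. by move=> a0 ah; rewrite -tan0 tan_lt // oppr_lt0 pihalf_gt0. Qed.

Lemma tan_lt0_pihalf a : - h < a -> a < 0 -> tan a < 0.
Proof. by move=> ha a0; rewrite -[X in _ < X]tan0 tan_lt // pihalf_gt0. Qed.

(* As [tan (2 a + pi / 2) = (t - 1 / t) / 2] with [t = tan a], this amounts to
   [1 / p + 1 / q <= 1 / (p + q)] for [p, q < 0]; in the next lemma it is the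
   same inequality for [p < 0 < q] and [p + q > 0]. *)
Lemma merge_double_neg a b : - h < a -> a < 0 -> - h < b -> b < 0 ->
  2 * merge0 a b + h <= merge0 (2 * a + h) (2 * b + h).
Proof.
move=> ha a0 hb b0; have p0 := pihalf_gt0; rewrite merge0_in //.
have ta := tan_lt0_pihalf ha a0; have tb := tan_lt0_pihalf hb b0.
have nz c : - h < c -> c < 0 -> cos c != 0 /\ sin c != 0.
  move=> hc c0; have := tan_lt0_pihalf hc c0; rewrite /tan => tc.
  by split; apply/negP => /eqP e0; move: tc; rewrite e0 ?invr0 ?mulr0 ?mul0r ltxx.
have [ca sa] := nz _ ha a0; have [cb sb] := nz _ hb b0.
set c := atan _; have hc : - h < c := atan_gtNpi2 _.
have tc : tan c = tan a + tan b by rewrite atanK.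
have c0 : c < 0 by rewrite -atan0 lt_atan //; lra.
have [cc sc] := nz _ hc c0.
rewrite merge0_in; [|lra|lra].
rewrite -[X in X <= _]atan_tan; [|lra|lra].
rewrite le_atan // !tan_double // tc.
move: (tan a) (tan b) ta tb => p q p0' q0.
have -> : (p + q - (p + q)^-1) / 2 = (p - p^-1) / 2 + (q - q^-1) / 2
    + ((p ^+ 2 + p * q + q ^+ 2) / (p * q * (p + q))) / 2.
  by field; rewrite !lt_eqF //; lra.
rewrite gerDl pmulr_lle0 ?invr_gt0 // mulr_ge0_le0 //.
  by nra.
rewrite invr_le0 nmulr_lle0; nra.
Qed.

Lemma merge_double_mixed a b : - h < a -> a < 0 -> 0 < b -> b < h ->
  0 < tan a + tan b ->
  2 * merge0 a b - h <= merge0 (2 * a + h) (2 * b - h).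
Proof.
move=> ha a0 b0 bh t0; have p0 := pihalf_gt0; rewrite merge0_in //; last by lra.
have ta := tan_lt0_pihalf ha a0; have tb := tan_gt0_pihalf b0 bh.
have nz c : tan c != 0 -> cos c != 0 /\ sin c != 0.
  rewrite /tan => tc.
  by split; apply/negP => /eqP e0; move: tc; rewrite e0 ?invr0 ?mulr0 ?mul0r eqxx.
have [ca sa] := nz a (ltr0_neq0 ta); have [cb sb] := nz b (lt0r_neq0 tb).
set c := atan _; have tc : tan c = tan a + tan b by rewrite atanK.
have [cc sc] : cos c != 0 /\ sin c != 0 by apply: nz; rewrite tc lt0r_neq0.
have c0 : 0 < c by rewrite -atan0 lt_atan.
have ch : c < h := atan_ltpi2 _.
have tshift z : tan (2 * z - h) = tan (2 * z + h).
  have <- : 2 * z - h + pi = 2 * z + h by lra.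
  by rewrite tanDpi.
rewrite merge0_in; [|lra|lra].
rewrite -[X in X <= _]atan_tan; [|lra|lra].
rewrite le_atan // !tshift !tan_double // tc.
move: (tan a) (tan b) ta tb t0 => p q p0' q0 t0.
have -> : (p + q - (p + q)^-1) / 2 = (p - p^-1) / 2 + (q - q^-1) / 2
    + ((p ^+ 2 + p * q + q ^+ 2) / (p * q * (p + q))) / 2.
  by field; rewrite (lt_eqF p0') (gt_eqF q0) (gt_eqF t0).
rewrite gerDl pmulr_lle0 ?invr_gt0 // mulr_ge0_le0 //.
  by nra.
by rewrite invr_le0 pmulr_lle0 // nmulr_rle0 // ltW.
Qed.

(** Once turns are removed and the residues ordered, double angles are needed only for
    [- pi / 2 < a < 0] with [b < 0] or [tan a + tan b > 0]. In the other cases monotonicity and the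
    explicit values of [merge] at [- pi / 2] and [pi / 2] suffice. *)
Lemma merge_double x y : 2 * merge x y + h <= merge (2 * x + h) (2 * y + h).
Proof.
have [n [a [ha ah ->]]] := turns_spec x; have [m [b [hb bh ->]]] := turns_spec y.
rewrite mergeE // !double_turn merge_turn !intrD.
suff : 2 * merge0 a b + h <= merge (2 * a + h) (2 * b + h) by lra.
have p0 := pihalf_gt0; have [c1 c2] := merge0_itv a b.
wlog ab : a b ha ah hb bh c1 c2 / a <= b.
  move=> W; have /orP[] := le_total a b => ab; first exact: W.
  have mC : merge0 a b = merge0 b a by rewrite /merge0 orbC [tan a + _]addrC.
  by rewrite mC in c1 c2 *; rewrite mergeC W.
move: ha; rewrite le_eqVlt => /predU1P[aE|ha].
  rewrite -aE merge0_edge.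
  have -> : 2 * - h + h = - h by lra.
  rewrite -{1}merge_edge2; apply: le_merge; lra.
have hb' : - h < b by exact: lt_le_trans ab.
(* As a phase, [pi / 2] is one turn with residue [- pi / 2]. *)
have edge2 : merge h h = pi + h :> R.
  have := @merge_turn 1 1 (- h) (- h); rewrite merge_edge2 !mul1r.
  have -> : pi - h = h :> R by lra.
  move=> ->; rewrite intrD; lra.
have edge1 : merge (- h) h = h :> R.
  have := @merge_turn 0 1 (- h) (- h); rewrite merge_edge2 mul0r !mul1r !add0r.
  have -> : pi - h = h :> R by lra.
  by move=> ->; lra.
have [a0|a0] := leP 0 a.
  apply: (@le_trans _ _ (merge h h)); first by rewrite edge2; lra.
  by apply: le_merge; lra.
have [b0|b0] := ltP b 0.
  by rewrite mergeE0; [exact: merge_double_neg|lra..].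
have [t0|t0] := ltP 0 (tan a + tan b); last first.
  apply: (@le_trans _ _ (merge (- h) h)).
    have : merge0 a b <= 0 by rewrite merge0_in // -atan0 le_atan.
    by rewrite edge1; lra.
  by apply: le_merge; lra.
have b1 : 0 < b.
  rewrite lt_neqAle b0 andbT; apply/negP => /eqP bE.
  by have := tan_lt0_pihalf ha a0; move: t0; rewrite -bE tan0; lra.
(* Here [2 b + pi / 2] has passed into the next turn and is brought back by [pi]. *)
have := @merge_turn 0 1 (2 * a + h) (2 * b - h); rewrite mul0r !mul1r !add0r.
have -> : pi + (2 * b - h) = 2 * b + h :> R by lra.
move=> ->; rewrite mergeE0; [|lra..].
by have := merge_double_mixed ha a0 b1 bh t0; lra.
Qed.

End Merge.

(** * Phases along a rooted tree *)

Section Phases.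
Context {R : realType}.
Local Notation h := (pi / 2 : R).

(* [f] is the phase of a branch as a function of the frequency, and [g] is its
   limit from the left. *)
Definition phase_pair (f g : R -> R) : Prop :=
  [/\ forall s, 0 <= s -> g s <= f s,
      forall u s, 0 <= u -> u < s -> f u <= g s,
      forall s e, 0 <= s -> 0 < e -> exists u, s < u /\ f u < f s + e
    & forall s e, 0 < s -> 0 < e -> exists u, [/\ 0 <= u, u < s & g s - e < g u]].

Lemma phase_pair_mono f g u s : phase_pair f g -> 0 <= u -> u <= s ->
  f u <= f s /\ g u <= g s.
Proof.
move=> [gf fg _ _] u0; rewrite le_eqVlt => /predU1P[-> //|us].
have s0 : 0 <= s by rewrite (le_trans u0) // ltW.
split; first exact: le_trans (fg _ _ u0 us) (gf _ s0).
exact: le_trans (gf _ u0) (fg _ _ u0 us).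
Qed.

Lemma phase_pair_cst c : phase_pair (fun=> c) (fun=> c).
Proof.
split=> // s e s0 e0; first by exists (s + 1); lra.
by exists 0; split => //; lra.
Qed.

(** The length term makes the phase strictly increasing even where that of the branch is constant;
    the second conclusion is the strictness that merging requires. *)
Lemma phase_pair_edge f g l : 0 < l -> phase_pair f g ->
  phase_pair (fun s => f s + s * l) (fun s => g s + s * l) /\
  (forall u s, 0 <= u -> u < s -> f u + u * l < g s + s * l).
Proof.
move=> l0 fgP; have [gf fg fr gl] := fgP.
have strict u s : 0 <= u -> u < s -> f u + u * l < g s + s * l.
  by move=> u0 us; rewrite ler_ltD ?fg // ltr_pM2r.
split=> //; split.
- by move=> s s0; rewrite lerD2r gf.
- by move=> u s u0 us; rewrite ltW // strict.
- move=> s e s0 e0.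
  have [u [su fu]] := fr s (e / 2) s0 (divr_gt0 e0 (ltr0Sn _ 1)).
  pose d := Num.min (u - s) (e / 2 / l).
  have d0 : 0 < d by rewrite lt_min subr_gt0 su !divr_gt0.
  have du : d <= u - s by rewrite ge_min lexx.
  have dl : d * l <= e / 2 by rewrite -ler_pdivlMr // ge_min lexx orbT.
  exists (s + d); split; first lra.
  have [||fd _] := phase_pair_mono (u := s + d) (s := u) fgP; [lra|lra|].
  by rewrite mulrDl; lra.
- move=> s e s0 e0.
  have [u [u0 us gu]] := gl s (e / 2) s0 (divr_gt0 e0 (ltr0Sn _ 1)).
  pose d := Num.min (s - u) (e / 2 / l).
  have d0 : 0 < d by rewrite lt_min subr_gt0 us !divr_gt0.
  have du : d <= s - u by rewrite ge_min lexx.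
  have dl : d * l <= e / 2 by rewrite -ler_pdivlMr // ge_min lexx orbT.
  exists (s - d); split; [lra|lra|].
  have [||_ fd] := phase_pair_mono (u := u) (s := s - d) fgP; [lra|lra|].
  by rewrite mulrBl; lra.
Qed.

Lemma phase_pair_merge f1 g1 f2 g2 : phase_pair f1 g1 -> phase_pair f2 g2 ->
  (forall u s, 0 <= u -> u < s -> f2 u < g2 s) ->
  phase_pair (fun s => merge (f1 s) (f2 s)) (fun s => merge_lower (g1 s) (g2 s)).
Proof.
move=> P1 P2 lt2; have [gf1 fg1 fr1 gl1] := P1; have [gf2 fg2 fr2 gl2] := P2.
split.
- move=> s s0; apply: (@le_trans _ _ (merge (g1 s) (g2 s))).
    by rewrite merge_lowerE gerBl mulr_ge0 ?ler0n ?pi_ge0.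
  by rewrite le_merge ?gf1 ?gf2.
- by move=> u s u0 us; rewrite merge_ltl ?fg1 ?lt2.
- move=> s e s0 e0; have [d d0 md] := merge_right (f1 s) (f2 s) e0.
  have [u1 [su1 fu1]] := fr1 s d s0 d0; have [u2 [su2 fu2]] := fr2 s d s0 d0.
  exists (Num.min u1 u2); set u := Num.min _ _.
  have su : s < u by rewrite lt_min su1.
  have u0 : 0 <= u by rewrite (le_trans s0) // ltW.
  split=> //; apply: le_lt_trans md; apply: le_merge.
    have [//||fu _] := phase_pair_mono (u := u) (s := u1) P1; first by rewrite ge_min lexx.
    by rewrite (le_trans fu) // ltW.
  have [//||fu _] := phase_pair_mono (u := u) (s := u2) P2; first by rewrite ge_min lexx orbT.
  by rewrite (le_trans fu) // ltW.
- move=> s e s0 e0; have [d d0 md] := merge_left (g1 s) (g2 s) e0.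
  have [u1 [u10 su1 fu1]] := gl1 s d s0 d0; have [u2 [u20 su2 fu2]] := gl2 s d s0 d0.
  exists (Num.max u1 u2); set u := Num.max _ _.
  have us : u < s by rewrite gt_max su1.
  split=> //; first by rewrite le_max u10.
  apply: lt_le_trans md _; apply: merge_lower_le.
    have [//||_ fu] := phase_pair_mono (u := u1) (s := u) P1; first by rewrite le_max lexx.
    by rewrite (le_trans _ fu) // ltW.
  have [//||_ fu] := phase_pair_mono (u := u2) (s := u) P2; first by rewrite le_max lexx orbT.
  by rewrite (le_trans _ fu) // ltW.
Qed.

(* This reads [g (2 s) >= 2 g s] for [g = f + pi / 2], the phase counted from the
   Dirichlet condition. *)
Definition superhomogeneous (f : R -> R) : Prop :=
  f 0 = - h /\ forall s, 0 <= s -> 2 * f s + h <= f (2 * s).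

End Phases.

(* A tree is described from its root by attaching pendant edges one at a time.
   In a list of steps [(c, p, e)] the head is the last one: the edge [e] then
   joins the new vertex [c] to the vertex [p] of the tree built by the tail. *)
Section Build.
Context {V E : finType} (r : V).
Implicit Types (x : V * V * E) (l : seq (V * V * E)) (v : V) (A : pred V).

Fixpoint built l : seq V := if l is x :: l' then x.1.1 :: built l' else [:: r].

Fixpoint well_built l : bool :=
  if l is x :: l' then [&& x.1.1 \notin built l', x.1.2 \in built l' & well_built l']
  else true.

Definition upd {T : Type} (f : V -> T) v (t : T) : V -> T :=
  fun w => if w == v then t else f w.

(* Every vertex that is eliminated is in [A] or has received a branch before. *)
Fixpoint active l A : bool :=
  if l is x :: l' then A x.1.1 && active l' (predU1 x.1.2 A) else true.

Lemma built_root l : r \in built l.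
Proof. by elim: l => [|x l ih] /=; rewrite ?mem_seq1 // inE ih orbT. Qed.

Lemma uniq_built l : well_built l -> uniq (built l).
Proof. by elim: l => //= x l ih /and3P[-> _ /ih]. Qed.

Context {R : realType} (len : E -> R).
Local Notation h := (pi / 2 : R).

Definition branch (s : R) (th : V -> R) x : R := th x.1.1 + s * len x.2.

(** The operation is a parameter because the same recursion is run with [merge] for the phase and
    with [merge_lower] for its left limit. *)
Fixpoint root_phase (mrg : R -> R -> R) (s : R) l (th : V -> R) : R :=
  if l is x :: l' then
    root_phase mrg s l' (upd th x.1.2 (mrg (th x.1.2) (branch s th x)))
  else th r.

(* The mergers of two branches that both vanish at the vertex: each one makes
   the phase jump by [pi] and creates one eigenfunction supported below it. *)
Fixpoint collisions (s : R) l (th : V -> R) : nat :=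
  if l is x :: l' then
    ((cos (th x.1.2) == 0%R) && (cos (branch s th x) == 0%R) +
     collisions s l' (upd th x.1.2 (merge (th x.1.2) (branch s th x))))%N
  else 0.

Lemma root_phase_pair l (f g : V -> R -> R) : (forall e, 0 < len e) ->
  (forall v, phase_pair (f v) (g v)) ->
  phase_pair (fun s => root_phase merge s l (f^~ s))
             (fun s => root_phase merge_lower s l (g^~ s)).
Proof.
move=> len0; elim: l f g => [|x l ih] f g fg /=; first exact: fg.
have [bP bL] := phase_pair_edge (len0 x.2) (fg x.1.1).
pose f' v s := upd (f^~ s) x.1.2 (merge (f x.1.2 s) (f x.1.1 s + s * len x.2)) v.
pose g' v s := upd (g^~ s) x.1.2 (merge_lower (g x.1.2 s) (g x.1.1 s + s * len x.2)) v.
apply: (ih f' g') => v; rewrite /f' /g' /upd; case: eqP => // _.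
exact: phase_pair_merge.
Qed.

(** The phase 0 of an inner vertex without branches is not superhomogeneous: counted from the
    Dirichlet condition it is the positive constant [pi / 2]. [A] marks the vertices that have the
    property; as 0 is neutral for [merge], a vertex enters [A] with its first branch. *)
Lemma root_phase_super l A (f : V -> R -> R) : active l A -> A r ->
  (forall v, A v -> superhomogeneous (f v)) ->
  (forall v, ~~ A v -> f v = fun=> 0) ->
  superhomogeneous (fun s => root_phase merge s l (f^~ s)).
Proof.
elim: l A f => [|x l ih] A f /=; first by move=> _ Ar fA _; exact: fA.
move=> /andP[Ac actl] Ar fA fN.
have [fc0 fcD] := fA _ Ac.
pose f' v s := upd (f^~ s) x.1.2 (merge (f x.1.2 s) (f x.1.1 s + s * len x.2)) v.
apply: (ih _ f' actl); first by rewrite /= Ar orbT.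
- move=> v; rewrite /f' /upd /=; have [-> _|_ /=] := eqVneq v x.1.2; last exact: fA.
  have [/fA[fp0 fpD]|/fN ->] := boolP (A x.1.2).
    split; first by rewrite fc0 fp0 mul0r addr0 merge_edge2.
    move=> s s0; apply: le_trans (merge_double _ _) _.
    by apply: le_merge; [exact: fpD|have := fcD s s0; lra].
  split; first by rewrite merge0x fc0 mul0r addr0.
  by move=> s s0; rewrite !merge0x; have := fcD s s0; lra.
- move=> v; rewrite /f' /upd /= negb_or => /andP[/negPf vp Av].
  by rewrite vp; exact: fN.
Qed.

(** For a root that is a leaf the final phase is quantized, since the Dirichlet phase is absorbing;
    this is what makes the count an integer. *)
Lemma root_phase_edge s l (th : V -> R) :
  (exists n : int, th r = n%:~R * pi - h) ->
  exists n : int, root_phase merge s l th = n%:~R * pi - h.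
Proof.
elim: l th => [//|x l ih] th thr /=; apply: ih; rewrite /upd.
have [rE|//] := eqVneq r x.1.2; rewrite -rE; have [n ->] := thr.
have := @merge_turn _ n 0 (- h) (branch s th x); rewrite mul0r add0r => ->.
by have [k ->] := merge_edge (branch s th x); exists (n + k); rewrite intrD; ring.
Qed.

(** The induction carries the deficits [d v] collected so far: [merge_lower] is equivariant under
    turns, so the deficits of two branches add up, and a collision adds one more. *)
Lemma root_phase_gap s l (f g : V -> R) (d : V -> nat) : well_built l ->
  (forall v, g v = f v - (d v)%:R * pi) ->
  root_phase merge_lower s l g = root_phase merge s l f -
    (\sum_(v <- built l) d v + collisions s l f)%N%:R * pi.
Proof.
elim: l f g d => [|x l ih] f g d /=.
  by move=> _ ->; rewrite big_seq1 addn0.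
move=> /and3P[cl pl wl] gE.
set b : bool := (_ && _).
pose d' := upd d x.1.2 (d x.1.2 + d x.1.1 + b)%N.
rewrite (ih (upd f x.1.2 (merge (f x.1.2) (branch s f x))) _ d' wl).
  congr (_ - _%:R * _); rewrite addnA; congr (_ + _)%N.
  rewrite big_cons (bigD1_seq _ pl (uniq_built wl)) /=.
  rewrite [in RHS](bigD1_seq _ pl (uniq_built wl)) /= {1}/d' /upd eqxx.
  rewrite (eq_bigr d) => [|v /negPf vp]; last by rewrite /d' /upd vp.
  by rewrite -!addnA [RHS]addnCA; congr (_ + (_ + _))%N; rewrite addnC.
move=> v; rewrite /upd /d' /upd; case: eqP => // _.
have -> : branch s g x = branch s f x - (d x.1.1)%:R * pi.
  by rewrite /branch gE; ring.
rewrite gE !pmulrn merge_lower_turn merge_lowerE -/b.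
by rewrite -!pmulrn !natrD; ring.
Qed.

End Build.

(** * Dimension of function spaces *)

Section Dimension.
Context {K : fieldType}.

Definition lincomb {T : Type} n (c : 'I_n -> K) (b : 'I_n -> T -> K) (t : T) : K :=
  \sum_(i < n) c i * b i t.

(** One notion for two uses: eigenspaces, whose elements are compared on the meaningful points [D]
    of the edges, and spaces of coefficient vectors on the vertices, where [D] is everything. *)
Definition hasdim {T : Type} (D : T -> Prop) (S : (T -> K) -> Prop) (n : nat) : Prop :=
  exists b : 'I_n -> T -> K,
    [/\ forall i, S (b i),
        forall c, (forall t, D t -> lincomb c b t = 0) -> forall i, c i = 0
      & forall f, S f -> exists c, forall t, D t -> f t = lincomb c b t].

Lemma hasdim_leq T (D : T -> Prop) S n m : hasdim D S n -> hasdim D S m -> (n <= m)%N.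
Proof.
move=> [b [bS bI _]] [b' [_ _ b'G]].
have /choice[M ME] : forall i, exists c : 'I_m -> K,
  forall t, D t -> b i t = lincomb c b' t by move=> i; exact: b'G.
pose A := \matrix_(i < n, j < m) M i j.
suff : row_free A by rewrite /row_free => /eqP <-; exact: rank_leq_col.
apply: inj_row_free => u uA.
have u0 : forall i, u 0 i = 0.
  apply: bI => t Dt; rewrite /lincomb.
  transitivity (\sum_(j < m) (u *m A) 0 j * b' j t).
    under eq_bigr => i _ do rewrite (ME i t Dt) mulr_sumr.
    rewrite exchange_big /=; apply: eq_bigr => j _.
    by rewrite mxE mulr_suml; apply: eq_bigr => i _; rewrite !mxE mulrA.
  by rewrite big1 // => j _; rewrite uA mxE mul0r.
by apply/rowP => i; rewrite u0 mxE.
Qed.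

Lemma hasdim_unique T (D : T -> Prop) S n m : hasdim D S n -> hasdim D S m -> n = m.
Proof.
by move=> Sn Sm; apply/eqP; rewrite eqn_leq (hasdim_leq Sn Sm) (hasdim_leq Sm Sn).
Qed.

Lemma lincomb_eq0 T n (c : 'I_n -> K) (b : 'I_n -> T -> K) t :
  (forall i, b i t = 0) -> lincomb c b t = 0.
Proof. by move=> b0; rewrite /lincomb big1 // => i _; rewrite b0 mulr0. Qed.

Definition linear_on {T T' : Type} (F : (T -> K) -> T' -> K) : Prop :=
  forall n (c : 'I_n -> K) b t, F (lincomb c b) t = lincomb c (fun i => F (b i)) t.

(** Injectivity is stated on combinations of elements of [S] because [S] is an arbitrary
    predicate. *)
Lemma hasdim_iso T T' (D : T -> Prop) (D' : T' -> Prop) S S'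
    (F : (T -> K) -> T' -> K) n :
  linear_on F ->
  (forall f, S f -> S' (F f)) ->
  (forall m (c : 'I_m -> K) b, (forall i, S (b i)) ->
     (forall t, D' t -> F (lincomb c b) t = 0) -> forall t, D t -> lincomb c b t = 0) ->
  (forall f', S' f' -> exists2 f, S f & forall t, D' t -> f' t = F f t) ->
  (forall f g, (forall t, D t -> f t = g t) -> forall t, D' t -> F f t = F g t) ->
  hasdim D S n -> hasdim D' S' n.
Proof.
move=> linF SF injF surF extF [b [bS bI bG]]; exists (fun i => F (b i)); split.
- by move=> i; exact/SF.
- move=> c c0; apply/bI/injF => // t Dt.
  by rewrite linF; exact: c0.
- move=> f' /surF[f /bG[c fE] f'E]; exists c => t Dt.
  by rewrite f'E // (extF _ _ fE) // linF.
Qed.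

Lemma hasdim_zero T (D : T -> Prop) (S : (T -> K) -> Prop) :
  (forall f, S f -> forall t, D t -> f t = 0) -> hasdim D S 0.
Proof.
move=> S0; exists (fun=> fun=> 0); split.
- by case.
- by move=> ? _ [].
- by move=> f Sf; exists (fun=> 0) => t Dt; rewrite /lincomb big_ord0 S0.
Qed.

(** [Q] is [P] plus a line: the value at [v] is free in [Q] and zero in [P]. In a collision, [v] is
    the vertex being eliminated. *)
Lemma hasdim_free_coordinate (V : eqType) (v : V) (P Q : (V -> K) -> Prop) n :
  (forall f, P f -> Q f /\ f v = 0) ->
  (forall f a, Q f -> P (fun w => if w == v then 0 else f w) /\
                      Q (fun w => if w == v then a else 0)) ->
  (exists f, Q f) ->
  hasdim (fun=> True) P n -> hasdim (fun=> True) Q n.+1.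
Proof.
move=> PQ QP [f0 Qf0] [b [bP bI bG]].
pose k : V -> K := fun w => if w == v then 1 else 0.
pose b' i := if unlift ord0 i is Some j then b j else k.
have b'0 : b' ord0 = k by rewrite /b' unlift_none.
have b'S j : b' (lift ord0 j) = b j by rewrite /b' liftK.
have lE c w : lincomb c b' w = c ord0 * k w + lincomb (fun j => c (lift ord0 j)) b w.
  rewrite /lincomb big_ord_recl b'0; congr (_ + _).
  by apply: eq_bigr => j _; rewrite b'S.
have bv c : lincomb c b v = 0.
  by rewrite /lincomb big1 // => j _; have [_ ->] := PQ _ (bP j); rewrite mulr0.
exists b'; split.
- move=> i; case: (unliftP ord0 i) => [j|] ->; last by rewrite b'0; case: (QP _ 1 Qf0).
  by rewrite b'S; case: (PQ _ (bP j)).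
- move=> c c0; have c00 : c ord0 = 0.
    by have := c0 v I; rewrite lE bv /k eqxx mulr1 addr0.
  move=> i; case: (unliftP ord0 i) => [j|] -> //.
  apply: (bI (fun j => c (lift ord0 j))) => w _.
  by have := c0 w I; rewrite lE c00 mul0r add0r.
- move=> f Qf; have [Pf _] := QP f 0 Qf; have [c cE] := bG _ Pf.
  exists (fun i => if unlift ord0 i is Some j then c j else f v) => w _.
  rewrite lE unlift_none.
  under [X in lincomb X]funext do rewrite liftK.
  rewrite -cE // /k; case: eqP => [->|_]; first by rewrite mulr1 addr0.
  by rewrite mulr0 add0r.
Qed.

End Dimension.

(** * Elimination of pendant edges *)

Section Elimination.
Context {R : realType} {V E : finType} (r : V) (len : E -> R) (s : R).
Local Notation C := R[i].
Implicit Types (x : V * V * E) (l : seq (V * V * E)) (th : V -> R) (a : V -> C).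

Definition cosC (t : R) : C := (cos t)%:C.
Definition sinC (t : R) : C := (sin t)%:C.

Lemma cosCD t u : cosC (t + u) = cosC t * cosC u - sinC t * sinC u.
Proof. by rewrite /cosC cosD rmorphB !rmorphM. Qed.

Lemma sinCD t u : sinC (t + u) = sinC t * cosC u + cosC t * sinC u.
Proof. by rewrite /sinC sinD rmorphD !rmorphM. Qed.

Lemma cos2sin2C t : cosC t ^+ 2 + sinC t ^+ 2 = 1.
Proof. by rewrite -!rmorphXn -rmorphD cos2Dsin2. Qed.

Lemma sinC_sqr t : cosC t = 0 -> sinC t * sinC t = 1.
Proof. by move=> c0; rewrite -(cos2sin2C t) c0; ring. Qed.

(** A rotation: the state [(a cos t, - a sin t)] becomes [(a cos (t + s l), - a sin (t + s l))],
    which is why an edge adds [s l] to the phase. *)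
Definition propagate (v w : C) (l : R) : C * C :=
  (v * cosC (s * l) + w * sinC (s * l), w * cosC (s * l) - v * sinC (s * l)).

(* [v] gives the values at the vertices and [w] the scaled fluxes into them
   through branches that are not described by [l]. *)
Fixpoint compat l (v w : V -> C) : Prop :=
  if l is x :: l' then
    let y := propagate (v x.1.1) (w x.1.1) (len x.2) in
    v x.1.2 = y.1 /\ compat l' v (upd w x.1.2 (w x.1.2 + y.2))
  else w r = 0.

Lemma compat_ext l v w v' w' : well_built r l ->
  (forall z, z \in built r l -> v z = v' z /\ w z = w' z) ->
  compat l v w -> compat l v' w'.
Proof.
elim: l v w v' w' => [|x l ih] v w v' w' /=.
  by move=> _ vw; have [|_ ->] := vw r; first exact: mem_head.
move=> /and3P[cl pl wl] vw.
have [vc wc] := vw x.1.1 (mem_head _ _).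
have [vp wp] : v x.1.2 = v' x.1.2 /\ w x.1.2 = w' x.1.2 by apply: vw; rewrite inE pl orbT.
rewrite vc wc vp wp => -[-> wK]; split=> //; apply: ih wK => // z zl.
have [vz wz] : v z = v' z /\ w z = w' z by apply: vw; rewrite inE zl orbT.
by rewrite /upd vz wz.
Qed.

(** Branches of joint phase [th z] allow, for value and flux at [z], only the multiples of one
    direction [(cos (th z), - sin (th z))]; the unknown [a z] is the multiple. *)
Definition sols l th a : Prop :=
  (forall z, z \notin built r l -> a z = 0) /\
  compat l (fun z => a z * cosC (th z)) (fun z => - (a z * sinC (th z))).

Lemma sols0 l th : sols l th (fun=> 0).
Proof.
split=> //; suff zero v w : (forall z, v z = 0) -> (forall z, w z = 0) -> compat l v w.
  by apply: zero => z; rewrite mul0r // oppr0.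
elim: l w => //= x l ih w v0 w0; rewrite /propagate !v0 !w0 !mul0r addr0; split=> //.
by apply: ih => // z; rewrite /upd; case: eqP => // _; rewrite subrr addr0.
Qed.

Lemma sols_cons x l th a : x.1.1 \notin built r l ->
  x.1.2 \in built r l -> well_built r l ->
  let q := branch len s th x in
  sols (x :: l) th a <->
  [/\ forall z, z \notin x.1.1 :: built r l -> a z = 0,
      a x.1.2 * cosC (th x.1.2) = a x.1.1 * cosC q
    & compat l (upd (fun z => a z * cosC (th z)) x.1.2 (a x.1.2 * cosC (th x.1.2)))
        (upd (fun z => - (a z * sinC (th z))) x.1.2
             (- (a x.1.2 * sinC (th x.1.2) + a x.1.1 * sinC q)))].
Proof.
move=> cl pl wl q; rewrite /sols /=.
have -> : a x.1.1 * cosC (th x.1.1) * cosC (s * len x.2) +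
    - (a x.1.1 * sinC (th x.1.1)) * sinC (s * len x.2) = a x.1.1 * cosC q.
  by rewrite /q /branch cosCD; ring.
have -> : - (a x.1.2 * sinC (th x.1.2)) +
   (- (a x.1.1 * sinC (th x.1.1)) * cosC (s * len x.2) -
   a x.1.1 * cosC (th x.1.1) * sinC (s * len x.2)) =
   - (a x.1.2 * sinC (th x.1.2) + a x.1.1 * sinC q).
  by rewrite /q /branch sinCD; ring.
have updE z : upd (fun z => a z * cosC (th z)) x.1.2 (a x.1.2 * cosC (th x.1.2)) z
    = a z * cosC (th z) by rewrite /upd; case: eqP => [->|].
by split=> [[a0 [ap aK]]|[a0 ap aK]]; split=> //; last split=> //;
  apply: compat_ext aK => // z _; rewrite updE.
Qed.

(** Both phases force the value 0 at [x.1.2], so matching values imposes nothing and only the total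
    flux matters there. Shifting flux between the two branches gives one new solution, parametrized
    by the coefficient at [x.1.1]. *)
Lemma sols_collision x l th n : x.1.1 \notin built r l ->
  x.1.2 \in built r l -> well_built r l ->
  let q := branch len s th x in
  cos (th x.1.2) = 0 -> cos q = 0 ->
  hasdim (fun=> True) (sols l (upd th x.1.2 (merge (th x.1.2) q))) n ->
  hasdim (fun=> True) (sols (x :: l) th) n.+1.
Proof.
move=> cl pl wl q cp cq; set th' := upd _ _ _.
have pc : (x.1.2 == x.1.1) = false.
  by apply/negP => /eqP e; rewrite -e pl in cl.
have cpF : (x.1.1 == x.1.2) = false by rewrite eq_sym.
have Cp : cosC (th x.1.2) = 0 by rewrite /cosC cp.
have Cq : cosC q = 0 by rewrite /cosC cq.
have Cm : cosC (merge (th x.1.2) q) = 0 by rewrite /cosC cos_merge_eq0.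
have sp := sinC_sqr Cp; have sq := sinC_sqr Cq; have sm := sinC_sqr Cm.
pose Q a := (forall z, z \notin x.1.1 :: built r l -> a z = 0) /\
  compat l (fun z => a z * cosC (th' z)) (fun z => - (a z * sinC (th' z))).
move=> /(@hasdim_free_coordinate _ _ x.1.1 _ Q) dimQ.
have {}dimQ : hasdim (fun=> True) Q n.+1.
  apply: dimQ; last by exists (fun=> 0); have [_ ?] := sols0 l th'; split.
  - move=> a [a0 aK]; split; last exact: a0.
    by split=> // z; rewrite inE negb_or => /andP[_ /a0].
  - move=> a t [a0 aK]; split; split.
    + move=> z zl; case: eqP => // /eqP zc.
      by apply: a0; rewrite inE negb_or zc.
    + apply: compat_ext aK => // z zl; case: eqP => // zc.
      by rewrite -zc zl in cl.
    + move=> z; rewrite inE negb_or => /andP[/negPf -> //].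
    + have [_] := sols0 l th'; apply: compat_ext => // z zl; case: eqP => // zc.
      by rewrite -zc zl in cl.
(* The new coefficient at [x.1.2] keeps the total flux once the branch has taken its share;
   multiplying by [sin (th x.1.2)] is dividing by it, as its square is 1. *)
pose F (a : V -> C) : V -> C := upd a x.1.2
  ((a x.1.2 * sinC (merge (th x.1.2) q) - a x.1.1 * sinC q) * sinC (th x.1.2)).
apply: (hasdim_iso (F := F)) dimQ => [|a|j cf b aS|a|f g fg].

- move=> m c b t; rewrite /F /upd /lincomb; case: eqP => // _.
  rewrite !mulr_suml -sumrB mulr_suml.
  by apply: eq_bigr => i _; ring.
- move=> [a0 aK]; apply/sols_cons => //; split.
  + move=> z zl; rewrite /F /upd; case: eqP => [zp|_]; last exact: a0.
    by rewrite zp inE pl orbT in zl.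
  + by rewrite Cp -/q Cq !mulr0.
  + apply: compat_ext aK => // z zl; rewrite /F /th' /upd; case: eqP => [->|_].
      rewrite eqxx -/q Cp Cm !mulr0; split=> //; congr (- _).
      rewrite cpF -[_ * sinC (th _) * sinC (th _)]mulrA sp; ring.
    by [].
- set a := lincomb cf b => Fa t _; have := Fa t I; rewrite /F /upd; case: eqP => // -> e.
  have ac : a x.1.1 = 0 by have := Fa x.1.1 I; rewrite /F /upd cpF.
  move: e; rewrite ac mul0r subr0 => e.
  transitivity (a x.1.2 * (sinC (merge (th x.1.2) q) * sinC (merge (th x.1.2) q))
     * (sinC (th x.1.2) * sinC (th x.1.2))); first by rewrite sp sm; ring.
  transitivity (a x.1.2 * sinC (merge (th x.1.2) q) * sinC (th x.1.2)
     * (sinC (merge (th x.1.2) q) * sinC (th x.1.2))); first by ring.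
  by rewrite e mul0r.
- move=> /sols_cons[//|//|//|a0 _ aK].
  pose a' := upd a x.1.2 ((a x.1.2 * sinC (th x.1.2) + a x.1.1 * sinC q) *
     sinC (merge (th x.1.2) q)).
  exists a'; last first.
    move=> t _; rewrite /F /a' /upd eqxx cpF; case: eqP => // ->.
    rewrite -[_ * sinC (merge _ _) * sinC (merge _ _)]mulrA sm mulr1 addrK.
    by rewrite -mulrA sp mulr1.
  split=> [z zl|].
    rewrite /a' /upd; case: eqP => [zp|_]; last exact: a0.
    by rewrite zp inE pl orbT in zl.
  apply: compat_ext aK => // z zl; rewrite /a' /th' /upd; case: eqP => // _.
  by rewrite -/q Cp Cm !mulr0 -[_ * sinC (merge _ _) * sinC (merge _ _)]mulrA sm mulr1.
- by move=> t _; rewrite /F /upd !fg.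
Qed.

(** Matching values leaves the pairs [(a x.1.2, a x.1.1)] proportional to [(cos q, cos t)], a line
    because these do not both vanish. By [merge_dir] the resulting value and flux are a nonzero
    multiple of the direction of the merged phase. *)
Lemma sols_regular x l th n : x.1.1 \notin built r l ->
  x.1.2 \in built r l -> well_built r l ->
  let q := branch len s th x in
  ~~ ((cos (th x.1.2) == 0) && (cos q == 0)) ->
  hasdim (fun=> True) (sols l (upd th x.1.2 (merge (th x.1.2) q))) n ->
  hasdim (fun=> True) (sols (x :: l) th) n.
Proof.
move=> cl pl wl q npq; set th' := upd _ _ _; set t := th x.1.2 in npq *.
have pc : (x.1.2 == x.1.1) = false.
  by apply/negP => /eqP e; rewrite -e pl in cl.
set m := merge t q in th' *.
pose X := cosC t * cosC q; pose Y := sinC (t + q).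
have dir : cosC m * Y = sinC m * X.
  by rewrite /X /Y -!rmorphM /= -merge_dir.
(* [k] is the projection of [(X, Y)] on the unit vector of phase [m]; the two are parallel by
   [dir]. *)
pose k := cosC m * X + sinC m * Y.
have kX : k * cosC m = X.
  transitivity (cosC m ^+ 2 * X + sinC m * (cosC m * Y)); first by rewrite /k; ring.
  by rewrite dir -[RHS]mul1r -(cos2sin2C m); ring.
have kY : k * sinC m = Y.
  transitivity (cosC m * (sinC m * X) + sinC m ^+ 2 * Y); first by rewrite /k; ring.
  by rewrite -dir -[RHS]mul1r -(cos2sin2C m); ring.
pose D := cosC t ^+ 2 + cosC q ^+ 2.
have D0 : D != 0.
  rewrite /D -!rmorphXn -rmorphD fmorph_eq0 paddr_eq0 ?sqr_ge0 //.
  by rewrite !expf_eq0.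
have k0 : k != 0.
  apply/negP => /eqP k0; move: kX kY; rewrite k0 !mul0r => X0 Y0.
  have ct : cosC t * D = 0.
    transitivity (cosC t * (cosC t ^+ 2) + X * cosC q); first by rewrite /D /X; ring.
    rewrite -X0 mul0r addr0.
    have [->|] := eqVneq (cosC t) 0; first by rewrite mul0r.
    move: X0 => /esym /eqP; rewrite mulf_eq0 => /orP[->//|/eqP q0] t0.
    move: Y0; rewrite /Y sinCD q0 mulr0 add0r => /esym /eqP.
    rewrite mulf_eq0 (negPf t0) /= => /eqP s0.
    by have := cos2sin2C q; rewrite q0 s0 expr0n addr0 => /eqP; rewrite eq_sym oner_eq0.
  have cq : cosC q * D = 0.
    transitivity (cosC q * (cosC q ^+ 2) + X * cosC t); first by rewrite /D /X; ring.
    rewrite -X0 mul0r addr0.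
    have [->|] := eqVneq (cosC q) 0; first by rewrite mul0r.
    move: X0 => /esym /eqP; rewrite mulf_eq0 => /orP[/eqP q0|/eqP->]; last by rewrite eqxx.
    move: Y0; rewrite /Y sinCD q0 mul0r addr0 => /esym /eqP.
    rewrite mulf_eq0 => /orP[/eqP s0|->//] _.
    by have := cos2sin2C t; rewrite q0 s0 expr0n addr0 => /eqP; rewrite eq_sym oner_eq0.
  have : D * D = 0 by rewrite {1}/D mulrDl -!mulrA ct cq !mulr0 addr0.
  by move=> /eqP; rewrite mulf_eq0 orbb (negPf D0).
pose F (a : V -> C) : V -> C := upd (upd a x.1.2 (a x.1.2 / k * cosC q))
  x.1.1 (a x.1.2 / k * cosC t).
apply: (hasdim_iso (F := F)) => [|a|j cf b aS|a|f g fg].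

- move=> j c b z; rewrite /F /upd /lincomb; case: eqP => // _; last case: eqP => // _;
    by rewrite !mulr_suml; apply: eq_bigr => i _; ring.
- move=> [a0 aK]; apply/sols_cons => //; rewrite /F /upd pc !eqxx -/q -/t; split.
  + move=> z; rewrite inE negb_or => /andP[/negPf -> zl].
    by case: eqP => [zp|_]; [rewrite zp pl in zl|exact: a0].
  + by ring.
  + apply: compat_ext aK => // z zl; rewrite /th' /upd; case: eqP => [->|_].
      rewrite -/m; split; first by rewrite -[cosC m](mulKf k0) kX /X; ring.
      by rewrite -[sinC m](mulKf k0) kY /Y sinCD; ring.
    by case: eqP => // zc; rewrite -zc zl in cl.
- set a := lincomb cf b => Fa z _.
  have ac : a x.1.1 = 0 by apply: lincomb_eq0 => i; have [b0 _] := aS i; exact: b0.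
  have Fc := Fa x.1.1 I; have Fp := Fa x.1.2 I.
  rewrite /F /upd eqxx in Fc; rewrite /F /upd pc eqxx in Fp.
  have ap : a x.1.2 = 0.
    have : a x.1.2 / k * D = 0.
      transitivity (a x.1.2 / k * cosC t * cosC t + a x.1.2 / k * cosC q * cosC q).
        by rewrite /D; ring.
      by rewrite Fc Fp !mul0r addr0.
    by move=> /eqP; rewrite !mulf_eq0 invr_eq0 (negPf k0) (negPf D0) !orbF => /eqP.
  have := Fa z I; rewrite /F /upd; case: eqP => [->//|_]; case: eqP => [->//|//].
- move=> /sols_cons[//|//|//|a0 ap aK]; rewrite -/t -/q in ap aK.
  (* The coordinate along [(cos q, cos t)], found by orthogonal projection so that neither cosine
     has to be inverted. *)
  pose b := (a x.1.2 * cosC q + a x.1.1 * cosC t) / D.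
  have bp : b * cosC q = a x.1.2.
    transitivity ((a x.1.2 * cosC q ^+ 2 + (a x.1.1 * cosC q) * cosC t) / D).
      by rewrite /b; ring.
    rewrite -ap; transitivity (a x.1.2 * (D / D)); first by rewrite /D; ring.
    by rewrite divff // mulr1.
  have bc : b * cosC t = a x.1.1.
    transitivity ((a x.1.1 * cosC t ^+ 2 + (a x.1.2 * cosC t) * cosC q) / D).
      by rewrite /b; ring.
    rewrite ap; transitivity (a x.1.1 * (D / D)); first by rewrite /D; ring.
    by rewrite divff // mulr1.
  exists (fun z => if z == x.1.1 then 0 else upd a x.1.2 (k * b) z).
    split=> [z zl|].
      case: eqP => // /eqP zc; rewrite /upd; case: eqP => [zp|_].
        by rewrite zp pl in zl.
      by apply: a0; rewrite inE negb_or zc.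
    apply: compat_ext aK => // z zl; rewrite /th' /upd.
    have -> : (z == x.1.1) = false by apply/negP => /eqP zc; rewrite -zc zl in cl.
    case: eqP => // _; split.
      by rewrite mulrAC kX -bp /X; ring.
    by rewrite mulrAC kY -bp -bc /Y sinCD; ring.
  move=> z _; rewrite /F /upd pc eqxx [k * b]mulrC mulfK //.
  by case: eqP => [->|_]; [rewrite bc | case: eqP => [->|]; rewrite ?bp].
- by move=> z _; rewrite /F /upd !fg.
Qed.

(** Each collision adds one dimension, the other steps none. At the end the root phase is Dirichlet,
    so its sine is nonzero and zero total flux kills the last coefficient. *)
Lemma hasdim_sols l th : well_built r l -> cos (th r) = 0 ->
  hasdim (fun=> True) (sols l th) (collisions len s l th).
Proof.
elim: l th => [|x l ih] th.
  move=> _ thr; apply: hasdim_zero => a [a0 /= ar] z _.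
  have [->|zr] := eqVneq z r; last by apply: a0; rewrite mem_seq1.
  have c0 : cosC (th r) = 0 by rewrite /cosC thr.
  move: ar => /eqP; rewrite oppr_eq0 mulf_eq0 => /orP[/eqP //|/eqP s0].
  by have := sinC_sqr c0; rewrite s0 mul0r => /eqP; rewrite eq_sym oner_eq0.
rewrite [well_built _ _]/= => /and3P[cl pl wl] thr.
have {}ih := ih (upd th x.1.2 (merge (th x.1.2) (branch len s th x))) wl.
have {}ih : hasdim (fun=> True)
    (sols l (upd th x.1.2 (merge (th x.1.2) (branch len s th x))))
    (collisions len s l (upd th x.1.2 (merge (th x.1.2) (branch len s th x)))).
  by apply: ih; rewrite /upd; case: eqP => // rp; rewrite cos_merge_eq0 // -rp.
rewrite /=; case: (boolP (_ && _)) => [/andP[/eqP cp /eqP cq]|ncq].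
  exact: sols_collision.
exact: sols_regular ncq ih.
Qed.

End Elimination.

(** * Decomposition of a tree *)

Section Decomposition.
Context {R : realType} (G : metric_graph R).
Local Notation V := (vertex G).
Local Notation E := (edge G).
Implicit Types (x : V * V * E) (l : seq (V * V * E)) (e : E) (c p r v : V).

Definition joins e c p : bool :=
  ((src e == c) && (tgt e == p)) || ((src e == p) && (tgt e == c)).

Definition joined l : bool := all (fun x => joins x.2 x.1.1 x.1.2) l.

Lemma joined_built r l x : well_built r l -> joined l -> x \in l ->
  src x.2 \in built r l /\ tgt x.2 \in built r l.
Proof.
elim: l => //= y l ih /and3P[cl pl wl] /andP[jy jl]; rewrite inE.
case/predU1P => [->|/(ih wl jl)[sx tx]]; last by rewrite !inE sx tx !orbT.
by case/orP: jy => /andP[/eqP -> /eqP ->]; rewrite !inE eqxx pl !orbT.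
Qed.

Lemma uniq_edges r l : well_built r l -> joined l -> uniq [seq x.2 | x <- l].
Proof.
elim: l => //= x l ih /and3P[cl pl wl] /andP[jx jl]; rewrite (ih wl jl) andbT.
apply/negP => /mapP[y yl xy]; have [sy ty] := joined_built wl jl yl.
rewrite -xy in sy ty; case/orP: jx => /andP[/eqP sx /eqP tx].
  by rewrite sx (negPf cl) in sy.
by rewrite tx (negPf cl) in ty.
Qed.

Lemma crossing_edge (A : {pred V}) : (exists u, u \in A) -> (exists u, u \notin A) ->
  exists c p e, [/\ c \notin A, p \in A & joins e c p].
Proof.
move=> [u uA] [v vA]; apply: contrapT => nocross.
pose g : rel V := [rel a b | [exists e, ((src e == a) && (tgt e == b))
                               || ((src e == b) && (tgt e == a))]].
have Aclosed : fingraph.closed g A.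
  move=> a b /existsP[e je].
  have [aA|aA] := boolP (a \in A); have [bA|bA] := boolP (b \in A) => //;
    case: nocross.
  - by exists b, a, e; split => //; rewrite /joins orbC.
  - by exists a, b, e.
by have := closed_connect Aclosed (graph_connected u v); rewrite uA (negPf vA).
Qed.

Lemma grow r k : (k < #|V|)%N ->
  exists l, [/\ well_built r l, joined l & size l = k].
Proof.
elim: k => [|k ih] kV; first by exists [::].
have [l [wl jl sl]] := ih (ltnW kV).
have sb : size (built r l) = k.+1.
  by rewrite -sl; elim: (l) => //= y l' ->.
have [||c [p [e [cl pl jc]]]] := @crossing_edge [in built r l].
- by exists r; exact: built_root.
- apply: contrapT => all_built.
  have : (#|V| <= size (built r l))%N.
    rewrite -(card_uniqP (uniq_built wl)); apply: subset_leq_card; apply/fintype.subsetP => u _.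
    by apply: contrapT => ul; apply: all_built; exists u; exact/negP.
  by rewrite sb leqNgt kV.
by exists ((c, p, e) :: l) => /=; rewrite cl pl wl jl sl jc.
Qed.

(** Growing a spanning tree takes [#|V|.-1] steps with distinct edges; in a tree this is the number
    of all edges, so none is left out. *)
Lemma tree_decomposition r : is_tree G ->
  exists l, [/\ well_built r l, joined l, forall v, v \in built r l &
               perm_eq [seq x.2 | x <- l] (index_enum E)].
Proof.
move=> /eqP tG; have V0 : (0 < #|V|)%N by apply/card_gt0P; exists r.
have EV : #|E| = #|V|.-1 by move: tG; rewrite /is_tree; move: V0; lia.
have [|l [wl jl sl]] := @grow r #|V|.-1; first by rewrite prednK.
have sb : size (built r l) = #|V|.
  rewrite -[RHS](prednK V0) -sl; elim: (l) => //= y l' -> //.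
exists l; split=> //.
  have /subset_cardP : #|built r l| = #|V| by rewrite (card_uniqP (uniq_built wl)).
  by move=> /(_ (fintype.subset_predT _)) Vl v; rewrite Vl.
apply: uniq_perm; [exact: uniq_edges wl jl|exact: index_enum_uniq|].
have /subset_cardP : #|[seq x.2 | x <- l]| = #|E|.
  by rewrite (card_uniqP (uniq_edges wl jl)) size_map sl EV.
by move=> /(_ (fintype.subset_predT _)) El e; rewrite El mem_index_enum.
Qed.

Lemma pendant_leaf e0 c p : joins e0 c p -> c != p ->
  (forall e, src e = c \/ tgt e = c -> e = e0) -> leaf c.
Proof.
rewrite /leaf /degree => + cp only; case/orP => /andP[/eqP s0 /eqP t0].
  have -> : #|[pred e | src e == c]| = #|pred1 e0|.
    apply: eq_card => e; rewrite !inE; apply/eqP/eqP => [se|->//].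
    by apply: only; left.
  have -> : #|[pred e | tgt e == c]| = #|@pred0 E|.
    apply: eq_card => e; rewrite !inE; apply/negP => /eqP te.
    by move: cp; rewrite -t0 -(only e) ?te ?eqxx //; right.
  by rewrite card1 card0.
have -> : #|[pred e | tgt e == c]| = #|pred1 e0|.
  apply: eq_card => e; rewrite !inE; apply/eqP/eqP => [se|->//].
  by apply: only; right.
have -> : #|[pred e | src e == c]| = #|@pred0 E|.
  apply: eq_card => e; rewrite !inE; apply/negP => /eqP te.
  by move: cp; rewrite -s0 -(only e) ?te ?eqxx //; left.
by rewrite card1 card0.
Qed.

Lemma tree_has_leaf : is_tree G -> (0 < #|E|)%N -> exists r, @leaf R G r.
Proof.
move=> tG /card_gt0P[e0 _].
have [[|x l] [wl jl _ El]] := @tree_decomposition (src e0) tG.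
  by have := perm_mem El e0; rewrite mem_index_enum.
exists x.1.1; move: wl jl => /= /and3P[cl pl wl] /andP[jx jl].
apply: (pendant_leaf jx); first by apply/eqP => cp; rewrite cp pl in cl.
move=> e eC; have := perm_mem El e; rewrite mem_index_enum inE => /orP[/eqP //|].
move=> /mapP[y yl ey]; have [sy ty] := joined_built wl jl yl; subst e.
by case: eC => eC; rewrite eC (negPf cl) in sy ty.
Qed.

(** If [x.1.1] is not a leaf it has a second edge. The steps of the tail stay away from [x.1.1], so
    this edge belongs to a step of [pre], already eliminated; the new vertex of that step is another
    one, hence its branch was delivered at [x.1.1]. *)
Lemma active_leaf r l : well_built r l -> joined l ->
  (forall e, e \in [seq x.2 | x <- l]) -> active l (@leaf R G).
Proof.
move=> wl jl El.
suff H suf pre (A : pred V) : l = pre ++ suf -> (forall v, leaf v -> A v) ->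
    (forall x, x \in pre -> A x.1.2) -> active suf A.
  exact: (H l [::]).
elim: suf pre A => //= x suf ih pre A lE Al Ap.
have wsuf : well_built r (x :: suf).
  by move: wl; rewrite lE; elim: (pre) => // y pre' ih' /= /and3P[_ _ /ih'].
have jsuf : joined (x :: suf) by move: jl; rewrite lE /joined all_cat => /andP[].
move: wsuf jsuf => /= /and3P[cl pl wsuf] /andP[jx jsuf].
apply/andP; split; last first.
  apply: (ih (rcons pre x)) => [|v lv|y]; first by rewrite cat_rcons.
    by rewrite /= Al ?orbT.
  by rewrite mem_rcons inE => /orP[/eqP ->|/Ap]; rewrite /= ?eqxx // => ->; rewrite orbT.
have [/Al //|nleaf] := boolP (leaf x.1.1).
apply: contrapT => nA; move: nleaf => /negP; apply.
apply: (pendant_leaf jx); first by apply/eqP => cp; rewrite cp pl in cl.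
move=> e eC; have := El e; rewrite lE map_cat /= mem_cat inE => /or3P[|/eqP //|].
  move=> /mapP[y yl ey]; subst e.
  have jy : joins y.2 y.1.1 y.1.2.
    by have /allP := jl; apply; rewrite lE mem_cat yl.
  have : x.1.1 != y.1.1.
    have := uniq_built wl; rewrite lE; elim: (pre) yl => //= z pre' ih'.
    rewrite inE => /orP[/eqP <-|/ih' ih''] /andP[zl] //.
    move=> _; apply: contraNneq zl => <-; elim: (pre') => //= [|w q].
      by rewrite mem_head.
    by rewrite inE orbC => ->.
  have cy : x.1.1 = y.1.1 \/ x.1.1 = y.1.2.
    by case/orP: jy => /andP[/eqP sy /eqP ty]; case: eC => <-; rewrite ?sy ?ty; auto.
  move=> ncy; case: cy => cy; first by rewrite cy eqxx in ncy.
  by case: nA; rewrite cy Ap.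
move=> /mapP[y yl ey]; have [sy ty] := joined_built wsuf jsuf yl; subst e.
by case: eC => eC; rewrite eC (negPf cl) in sy ty.
Qed.

End Decomposition.

(** * Balance equations *)

Section Balance.
Context {R : realType} (G : metric_graph R) (r : vertex G) (s : R).
Local Notation V := (vertex G).
Local Notation E := (edge G).
Local Notation C := R[i].
Implicit Types (x : V * V * E) (l : seq (V * V * E)) (v w : V -> C) (q : E -> C).

(* On the edge [e] the function is [v (src e) cos (s x) + q e sin (s x)]. *)
Definition edge_value v q (e : E) (t : R) : C :=
  v (src e) * cosC (s * t) + q e * sinC (s * t).

(** The derivative divided by [s]: with this scaling an edge acts on value and slope as a
    rotation. *)
Definition edge_slope v q (e : E) (t : R) : C :=
  q e * cosC (s * t) - v (src e) * sinC (s * t).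

Definition inflow v q (e : E) (z : V) : C :=
  (if tgt e == z then edge_slope v q e (len e) else 0) +
  (if src e == z then - q e else 0).

Definition balanced l v w q : Prop :=
  (forall x, x \in l -> edge_value v q x.2 (len x.2) = v (tgt x.2)) /\
  (forall z, z \in built r l -> w z + \sum_(x <- l) inflow v q x.2 z = 0).

(** The coefficient refers to the [src] end: it is the flux received at [x.1.1] if the edge starts
    there, and otherwise minus the flux that the edge brings into [x.1.2]. *)
Definition step_slope v w x : C :=
  if src x.2 == x.1.1 then w x.1.1
  else - (propagate s (v x.1.1) (w x.1.1) (len x.2)).2.

Fixpoint slope l v w : E -> C :=
  if l is x :: l' then
    let y := propagate s (v x.1.1) (w x.1.1) (len x.2) in
    upd (slope l' v (upd w x.1.2 (w x.1.2 + y.2))) x.2 (step_slope v w x)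
  else fun=> 0.

Lemma inflow_eq0 v q e z : src e != z -> tgt e != z -> inflow v q e z = 0.
Proof. by move=> /negPf sz /negPf tz; rewrite /inflow sz tz addr0. Qed.

Lemma step_balance v w q x : joins x.2 x.1.1 x.1.2 -> x.1.1 != x.1.2 ->
  let y := propagate s (v x.1.1) (w x.1.1) (len x.2) in
  (edge_value v q x.2 (len x.2) = v (tgt x.2) /\ w x.1.1 + inflow v q x.2 x.1.1 = 0) <->
  (v x.1.2 = y.1 /\ q x.2 = step_slope v w x).
Proof.
move=> jx cp; rewrite /propagate /step_slope /inflow /edge_value /edge_slope /=.
have := cos2sin2C (s * len x.2).
move: (cosC _) (sinC _) => c t ct.
case/orP: jx => /andP[/eqP sE /eqP tE]; rewrite !sE !tE eqxx.
  rewrite eq_sym (negPf cp); split=> [[e1 e2]|[e1 e2]].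
    have qE : q x.2 = w x.1.1.
      by apply/eqP; rewrite -subr_eq0 -oppr_eq0; apply/eqP; rewrite -e2; ring.
    by rewrite -e1 qE.
  by rewrite e1 e2; split; ring.
rewrite eq_sym in cp; rewrite (negPf cp); split=> [[e1 e2]|[e1 e2]].
  have wE : w x.1.1 = - (q x.2 * c - v x.1.2 * t).
    by apply/eqP; rewrite -subr_eq0; apply/eqP; rewrite -e2; ring.
  rewrite -e1 wE; split.
    by rewrite -[LHS]mulr1 -ct; ring.
  by rewrite -[LHS]mulr1 -ct; ring.
rewrite e1 e2; split; first by rewrite -[RHS]mulr1 -ct; ring.
transitivity (w x.1.1 * (1 - (c ^+ 2 + t ^+ 2))); first by ring.
by rewrite ct subrr mulr0.
Qed.

Lemma step_inflow v w q x : joins x.2 x.1.1 x.1.2 -> x.1.1 != x.1.2 ->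
  let y := propagate s (v x.1.1) (w x.1.1) (len x.2) in
  v x.1.2 = y.1 -> q x.2 = step_slope v w x -> inflow v q x.2 x.1.2 = y.2.
Proof.
move=> jx cp; rewrite /propagate /step_slope /inflow /edge_slope /=.
have := cos2sin2C (s * len x.2).
move: (cosC _) (sinC _) => c t ct.
case/orP: jx => /andP[/eqP sE /eqP tE]; rewrite !sE !tE !eqxx.
  by rewrite (negPf cp) => e1 ->; ring.
have /negPf pc : x.1.2 != x.1.1 by rewrite eq_sym.
by rewrite (negPf cp) pc => e1 ->; ring.
Qed.

(** [x.1.1] meets no edge of [l], so its equation involves the edge of [x] alone and determines it;
    the rest of the tree sees that edge only as extra flux into [x.1.2]. *)
Lemma balanced_cons l v w q x : well_built r (x :: l) -> joined (x :: l) ->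
  let y := propagate s (v x.1.1) (w x.1.1) (len x.2) in
  balanced (x :: l) v w q <->
  [/\ v x.1.2 = y.1, q x.2 = step_slope v w x &
      balanced l v (upd w x.1.2 (w x.1.2 + y.2)) q].
Proof.
move=> /= /and3P[cl pl wl] /andP[jx jl].
have cp : x.1.1 != x.1.2 by apply: contraNneq cl => ->.
have rest0 : \sum_(y <- l) inflow v q y.2 x.1.1 = 0.
  rewrite big_seq big1 // => y yl; have [sy ty] := joined_built wl jl yl.
  by apply: inflow_eq0; [move: sy|move: ty]; apply: contraTneq => ->.
have other z : z != x.1.1 -> z != x.1.2 -> inflow v q x.2 z = 0.
  move=> zc zp; apply: inflow_eq0; case/orP: jx => /andP[/eqP sE /eqP tE];
    by rewrite ?sE ?tE eq_sym.
split=> [[eE bE]|[e1 e2 [eE bE]]].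
  have [e1 e2] : v x.1.2 = (propagate s (v x.1.1) (w x.1.1) (len x.2)).1 /\
      q x.2 = step_slope v w x.
    apply/(step_balance v w q jx cp); split; first by apply: eE; rewrite mem_head.
    by have := bE x.1.1 (mem_head _ _); rewrite big_cons rest0 addr0.
  split=> //; split=> [y yl|z zl]; first by apply: eE; rewrite inE yl orbT.
  have := bE z; rewrite inE zl orbT big_cons => /(_ isT) bz; rewrite -[RHS]bz.
  rewrite /upd; case: eqP => [->|/eqP zp].
    by have /= <- := step_inflow jx cp e1 e2; rewrite -[LHS]addrA.
  by rewrite other ?add0r //; apply: contraNneq cl => <-.
have [e3 e4] := (step_balance v w q jx cp).2 (conj e1 e2).
split=> [y|z]; first by rewrite inE => /predU1P[->|/eE].
rewrite inE big_cons => /predU1P[->|zl]; first by rewrite rest0 addr0.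
rewrite -[RHS](bE z zl) /upd; case: eqP => [->|/eqP zp].
  by have /= <- := step_inflow jx cp e1 e2; rewrite -[RHS]addrA.
by rewrite other ?add0r //; apply: contraNneq cl => <-.
Qed.

Lemma balancedE l v w q : well_built r l -> joined l ->
  balanced l v w q <->
  compat r (@len R G) s l v w /\ (forall x, x \in l -> q x.2 = slope l v w x.2).
Proof.
elim: l w => [|x l ih] w /= wl jl.
  split=> [[_ bE]|[w0 _]]; last first.
    by split=> // z; rewrite big_nil addr0 mem_seq1 => /eqP ->.
  by have := bE r (mem_head _ _); rewrite big_nil addr0.
have uE := uniq_edges (r := r) (l := x :: l) wl jl.
have bC := @balanced_cons l v w q x wl jl.
move: wl jl uE => /and3P[cl pl wl] /andP[jx jl] /= /andP[xl _].
have notx y : y \in l -> (y.2 == x.2) = false.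
  by move=> yl; apply/negP => /eqP yx; move/mapP: xl; apply; exists y.
split=> [/bC[e1 e2 /ih[//|//|cE qE]]|[[e1 cE] qE]].
  split=> // y; rewrite inE => /predU1P[->|yl]; first by rewrite /upd eqxx.
  by rewrite /upd notx // qE.
apply/bC; split=> //.
  by have := qE x (mem_head _ _); rewrite /upd eqxx.
apply/ih => //; split=> // y yl.
by have := qE y; rewrite inE yl orbT => /(_ isT); rewrite {1}/upd notx.
Qed.

Lemma compat_lincomb l n (c : 'I_n -> C) (v w : 'I_n -> V -> C) :
  (forall i, compat r (@len R G) s l (v i) (w i)) ->
  compat r (@len R G) s l (lincomb c v) (lincomb c w).
Proof.
elim: l w => [|x l ih] w /= vw; first exact: lincomb_eq0.
split.
  rewrite /lincomb !mulr_suml -big_split /=; apply: eq_bigr => i _.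
  by have [-> _] := vw i; ring.
rewrite (_ : upd _ _ _ = lincomb c (fun i => upd (w i) x.1.2
  (w i x.1.2 + (propagate s (v i x.1.1) (w i x.1.1) (len x.2)).2))).
  by apply: ih => i; have [_] := vw i.
apply/funext => z; rewrite /lincomb /upd; case: eqP => // _.
rewrite /= !mulr_suml -sumrB -big_split /=.
by apply: eq_bigr => i _; ring.
Qed.

Lemma slope_lincomb l n (c : 'I_n -> C) (v w : 'I_n -> V -> C) e :
  slope l (lincomb c v) (lincomb c w) e = lincomb c (fun i => slope l (v i) (w i)) e.
Proof.
elim: l w => [|x l ih] w /=; first by rewrite lincomb_eq0.
rewrite (_ : upd (lincomb c w) _ _ = lincomb c (fun i => upd (w i) x.1.2
  (w i x.1.2 + (propagate s (v i x.1.1) (w i x.1.1) (len x.2)).2))); last first.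
  apply/funext => z; rewrite /lincomb /upd; case: eqP => // _.
  rewrite /= !mulr_suml -sumrB -big_split /=.
  by apply: eq_bigr => i _; ring.
rewrite {1}/upd /lincomb /step_slope /=; case: eqP => [->|ex]; last first.
  by rewrite ih; apply: eq_bigr => i _; rewrite /upd; case: eqP.
rewrite /upd eqxx; case: eqP => // _.
by rewrite !mulr_suml -sumrB -sumrN; apply: eq_bigr => i _; ring.
Qed.

End Balance.

(** * Analysis on one edge *)

Section OneEdge.
Context {R : realType}.
Local Notation mu := (@lebesgue_measure R).
Implicit Types (l m s x : R) (u v p f g : R -> R).

Lemma itv_cc_sub l x : x \in `]0, l[ -> x \in `[0, l].
Proof. by apply: subset_itv_oo_cc. Qed.

Lemma within_addr l f g : {within `[0, l], continuous f} ->
  {within `[0, l], continuous g} -> {within `[0, l], continuous (f \+ g)}.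
Proof. by move=> cf cg x; apply: continuousD; [exact: cf|exact: cg]. Qed.

Lemma within_mulr l f g : {within `[0, l], continuous f} ->
  {within `[0, l], continuous g} -> {within `[0, l], continuous (f \* g)}.
Proof. by move=> cf cg x; apply: continuousM; [exact: cf|exact: cg]. Qed.

Lemma within_cst l (c : R) : {within `[0, l], continuous (fun=> c)}.
Proof. by move=> x; exact: cvg_cst. Qed.

Lemma within_ext l f g : {in `[0, l], f =1 g} ->
  {within `[0, l], continuous f} -> {within `[0, l], continuous g}.
Proof.
by move=> fg; apply: subspace_eq_continuous => x xl; apply: fg; rewrite inE in xl.
Qed.

Lemma square_integrable_integrable l v : square_integrable l v ->
  mu.-integrable `[0, l] (EFin \o v).
Proof.
move=> [mv iv]; have mI : measurable `[0, l] by exact: measurable_itv.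
apply: (@le_integrable _ _ _ mu _ mI _ (fun x => (1 + v x ^+ 2)%:E)).
- exact/measurable_EFinP.
- move=> x _ /=; rewrite lee_fin [leRHS]ger0_norm ?addr_ge0 ?sqr_ge0 //.
  rewrite -[v x ^+ 2]real_normK ?num_real //.
  by have := sqr_ge0 (`|v x| - 1); rewrite sqrrB; have := normr_ge0 (v x); lra.
- rewrite (_ : (fun x => (1 + v x ^+ 2)%:E) =
    (cst 1%:E \+ (fun x => (v x ^+ 2)%:E))%E); last by apply/funext => x /=; rewrite EFinD.
  apply: integrableD => //.
  apply: (@continuous_compact_integrable R (cst 1)); first exact: segment_compact.
  exact: within_cst.
Qed.

Lemma H1_within_continuous l u v : 0 < l -> H1_deriv_real l u v ->
  {within `[0, l], continuous u}.
Proof.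
move=> l0 [/square_integrable_integrable iv uE].
have := parameterized_integral_continuous (ltW l0) iv.
move=> /(within_addr (@within_cst l (u 0))); apply: within_ext => x xl.
by rewrite [RHS]uE.
Qed.

Lemma H1_is_derive l u v x : H1_deriv_real l u v -> {within `[0, l], continuous v} ->
  x \in `]0, l[ -> is_derive x 1 u (v x).
Proof.
move=> [/square_integrable_integrable iv uE] cv xl.
have := xl; rewrite in_itv /= => /andP[x0 x1].
have l0 : 0 < l by exact: lt_trans x1.
have cx : {for x, continuous v}.
  by have [cin _ _] := (continuous_within_itvP v l0).1 cv; exact: cin.
have [dF F'] := continuous_FTC1_closed x1 iv x0 cx.
set F := fun x => _ in dF F'.
apply: (@near_eq_is_derive _ _ _ (cst (u 0) \+ F)).
  near=> y; rewrite /= [RHS]uE //; apply: itv_cc_sub.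
  by near: y; exact: near_in_itvoo.
have dF' : is_derive x 1 F (v x) by exact: (DeriveDef dF (etrans (esym (derive1E _ _)) F')).
by apply: is_derive_eq; rewrite add0r.
Unshelve. all: by end_near. Qed.

Lemma within_continuous_square_integrable l v :
  {within `[0, l], continuous v} -> square_integrable l v.
Proof.
move=> cv; split.
  by apply: subspace_continuous_measurable_fun => //; exact: measurable_itv.
apply: (@continuous_compact_integrable R (fun x => v x ^+ 2)).
  exact: segment_compact.
by apply: within_ext (within_mulr cv cv) => x _; rewrite expr2.
Qed.

Lemma mvt_itv l f df x : {within `[0, l], continuous f} ->
  (forall y, y \in `]0, l[ -> is_derive y 1 f (df y)) -> x \in `[0, l] -> 0 < x ->
  exists2 y, y \in `]0, l[ & f x - f 0 = df y * x.
Proof.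
move=> cf dfE; rewrite in_itv /= => /andP[_ xl] x0.
have sub y : y \in `]0, x[ -> y \in `]0, l[.
  by rewrite !in_itv /= => /andP[-> yx]; exact: lt_le_trans xl.
have dfx y : y \in `]0, x[ -> is_derive y 1 f (df y) by move=> /sub; exact: dfE.
have cfx : {within `[0, x], continuous f}.
  apply: continuous_subspaceW cf => y /=; rewrite !in_itv /= => /andP[-> yx].
  exact: le_trans xl.
have [y yE e] := MVT x0 dfx cfx.
by exists y; [exact: sub|rewrite e subr0].
Qed.

Lemma derive0_constant l f x : {within `[0, l], continuous f} ->
  (forall y, y \in `]0, l[ -> is_derive y 1 f 0) -> x \in `[0, l] -> f x = f 0.
Proof.
move=> cf df xl; have := xl; rewrite in_itv /= => /andP[+ _].
rewrite le_eqVlt => /predU1P[<- //|x0].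
have [y _] := mvt_itv cf df xl x0.
by rewrite mul0r => /eqP; rewrite subr_eq0 => /eqP.
Qed.

Lemma H1_of_derive l u v : 0 < l -> (forall x, is_derive x 1 u (v x)) ->
  continuous v -> H1_deriv_real l u v.
Proof.
move=> l0 du cv; have cu : continuous u.
  by move=> x; apply/differentiable_continuous/derivable1_diffP; exact: ex_derive.
split.
  exact/within_continuous_square_integrable/continuous_subspaceT.
move=> x; rewrite in_itv /= => /andP[+ xl]; rewrite le_eqVlt => /predU1P[<-|x0].
  by rewrite set_itv1 Rintegral_set1 addr0.
rewrite /Rintegral (@continuous_FTC2 _ v u) //.
- by rewrite -EFinB /= addrC subrK.
- exact: continuous_subspaceT.
- split; first by move=> y _; exact: ex_derive.
    by apply: cvg_at_right_filter; exact: cu.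
  by apply: cvg_at_left_filter; exact: cu.
- by move=> y _; rewrite derive1E; exact: derive_val.
Qed.

(* [u'' = - m u] in the sense of the definition of the Laplacian. *)
Definition H1_eigen l m u p : Prop :=
  H1_deriv_real l u p /\ H1_deriv_real l p (fun x => - (m * u x)).

Lemma H1_eigen_smooth l m u p : 0 < l -> H1_eigen l m u p ->
  [/\ {within `[0, l], continuous u}, {within `[0, l], continuous p},
      forall x, x \in `]0, l[ -> is_derive x 1 u (p x)
    & forall x, x \in `]0, l[ -> is_derive x 1 p (- (m * u x))].
Proof.
move=> l0 [up pu]; have cu := H1_within_continuous l0 up.
have cp := H1_within_continuous l0 pu; split=> // x; first exact: H1_is_derive.
apply: H1_is_derive pu _.
apply: within_ext (within_mulr (@within_cst l (- m)) cu) => y _ /=.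
by rewrite mulNr.
Qed.

Lemma is_derive_sin_scale s x : is_derive x 1 (fun t => sin (s * t)) (s * cos (s * x)).
Proof.
have d : is_derive x 1 (fun t => s * t) s.
  by apply: is_derive_eq; rewrite /GRing.scale /= mulr1 ?mulr0 ?addr0.
by have := is_derive1_comp (is_derive_sin (s * x)) d; rewrite mulrC.
Qed.

Lemma is_derive_cos_scale s x : is_derive x 1 (fun t => cos (s * t)) (- (s * sin (s * x))).
Proof.
have d : is_derive x 1 (fun t => s * t) s.
  by apply: is_derive_eq; rewrite /GRing.scale /= mulr1 ?mulr0 ?addr0.
by have := is_derive1_comp (is_derive_cos (s * x)) d; rewrite mulNr mulrC.
Qed.

Lemma continuous_sin_scale s : continuous (fun t : R => sin (s * t)).
Proof.
by move=> x; apply/differentiable_continuous/derivable1_diffP;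
  have [] := is_derive_sin_scale s x.
Qed.

Lemma continuous_cos_scale s : continuous (fun t : R => cos (s * t)).
Proof.
by move=> x; apply/differentiable_continuous/derivable1_diffP;
  have [] := is_derive_cos_scale s x.
Qed.

(* Variation of constants: the two combinations below have derivative 0. *)
Lemma H1_eigen_trig l s u p x : 0 < l -> s != 0 -> H1_eigen l (s ^+ 2) u p ->
  x \in `[0, l] ->
  u x = u 0 * cos (s * x) + p 0 / s * sin (s * x) /\
  p x = s * (p 0 / s * cos (s * x) - u 0 * sin (s * x)).
Proof.
move=> l0 s0 /(H1_eigen_smooth l0)[cu cp du dp] xl.
have cS := continuous_subspaceT (A := `[0, l]) (@continuous_sin_scale s).
have cC := continuous_subspaceT (A := `[0, l]) (@continuous_cos_scale s).
pose A := u * (fun t => cos (s * t)) + (fun=> - s^-1) * (p * (fun t => sin (s * t))).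
pose B := u * (fun t => sin (s * t)) + (fun=> s^-1) * (p * (fun t => cos (s * t))).
have cA : {within `[0, l], continuous A} :=
  within_addr (within_mulr cu cC) (within_mulr (@within_cst l _) (within_mulr cp cS)).
have dA y : y \in `]0, l[ -> is_derive y 1 A 0.
  move=> yl.
  have d1 := is_deriveM (du y yl) (is_derive_cos_scale s y).
  have d2 := is_deriveM (dp y yl) (is_derive_sin_scale s y).
  have d3 := is_deriveD d1 (is_deriveM (is_derive_cst (- s^-1) y 1) d2).
  by apply: (is_derive_eq d3); rewrite /GRing.scale /=; field.
have A0 := derive0_constant cA dA xl.
have cB : {within `[0, l], continuous B} :=
  within_addr (within_mulr cu cS) (within_mulr (@within_cst l _) (within_mulr cp cC)).
have dB y : y \in `]0, l[ -> is_derive y 1 B 0.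
  move=> yl.
  have d1 := is_deriveM (du y yl) (is_derive_sin_scale s y).
  have d2 := is_deriveM (dp y yl) (is_derive_cos_scale s y).
  have d3 := is_deriveD d1 (is_deriveM (is_derive_cst s^-1 y 1) d2).
  by apply: (is_derive_eq d3); rewrite /GRing.scale /=; field.
have B0 := derive0_constant cB dB xl.
have {A0} e1 : u x * cos (s * x) - s^-1 * (p x * sin (s * x)) = u 0.
  by move: A0; rewrite /A !fctE mulr0 sin0 cos0 mulNr => ->; rewrite mulr0 mulr1 mulr0 addr0.
have {B0} e2 : u x * sin (s * x) + s^-1 * (p x * cos (s * x)) = p 0 / s.
  by move: B0; rewrite /B !fctE mulr0 sin0 cos0 => ->; rewrite mulr0 add0r mulr1 mulrC.
have cs := cos2Dsin2 (s * x); rewrite -e1 -e2; split.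
  by rewrite -[LHS]mulr1 -cs; ring.
by rewrite -[LHS]mulr1 -cs; field.
Qed.

Lemma trig_H1_eigen l s (a b : R) : 0 < l ->
  H1_eigen l (s ^+ 2) (fun x => a * cos (s * x) + b * sin (s * x))
    (fun x => s * (b * cos (s * x) - a * sin (s * x))).
Proof.
move=> l0; have cC := @continuous_cos_scale s; have cS := @continuous_sin_scale s.
have ccst (c : R) : continuous (fun _ : R => c) by move=> z; exact: cvg_cst.
have cM (f g : R -> R) : continuous f -> continuous g -> continuous (f \* g).
  by move=> cf cg z; apply: continuousM; [exact: cf|exact: cg].
have cD (f g : R -> R) : continuous f -> continuous g -> continuous (f \+ g).
  by move=> cf cg z; apply: continuousD; [exact: cf|exact: cg].
have cp : continuous (fun x => s * (b * cos (s * x) - a * sin (s * x))).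
  rewrite (_ : (fun x => _) = (fun=> s) \* (((fun=> b) \* (fun x => cos (s * x))) \+
    ((fun=> - a) \* (fun x => sin (s * x))))).
    exact: cM _ _ (ccst s) (cD _ _ (cM _ _ (ccst b) cC) (cM _ _ (ccst (- a)) cS)).
  by apply/funext => z /=; ring.
have cu : continuous (fun x => - (s ^+ 2 * (a * cos (s * x) + b * sin (s * x)))).
  rewrite (_ : (fun x => _) = (fun=> - s ^+ 2) \* (((fun=> a) \* (fun x => cos (s * x))) \+
    ((fun=> b) \* (fun x => sin (s * x))))).
    exact: cM _ _ (ccst _) (cD _ _ (cM _ _ (ccst a) cC) (cM _ _ (ccst b) cS)).
  by apply/funext => z /=; ring.
have dcst c x := is_derive_cst (c : R) (x : R) (1 : R).
split; apply: H1_of_derive => // x.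
  have d := is_deriveD (is_deriveM (dcst a x) (is_derive_cos_scale s x))
                       (is_deriveM (dcst b x) (is_derive_sin_scale s x)).
  by apply: (is_derive_eq d); rewrite /GRing.scale /=; ring.
have d := is_deriveM (dcst s x) (is_deriveB
   (is_deriveM (dcst b x) (is_derive_cos_scale s x))
   (is_deriveM (dcst a x) (is_derive_sin_scale s x))).
by apply: (is_derive_eq d); rewrite /GRing.scale /=; ring.
Qed.

(** For [m <= 0] the derivative [p^2 - m u^2] of [u p] is nonnegative; equal end values make [u p]
    constant, which forces [p = 0] inside. *)
Lemma H1_eigen_energy l m u p : 0 < l -> m <= 0 -> H1_eigen l m u p ->
  u 0 * p 0 <= u l * p l /\
  (u l * p l = u 0 * p 0 -> forall x, x \in `[0, l] -> u x = u 0).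
Proof.
move=> l0 m0 /(H1_eigen_smooth l0)[cu cp du dp].
have dup y : y \in `]0, l[ -> is_derive y 1 (u * p) (p y ^+ 2 - m * u y ^+ 2).
  move=> yl; apply: (is_derive_eq (is_deriveM (du y yl) (dp y yl))).
  by rewrite /GRing.scale /=; ring.
have pos y : 0 <= p y ^+ 2 - m * u y ^+ 2.
  by have := sqr_ge0 (p y); have := mulr_le0_ge0 m0 (sqr_ge0 (u y)); lra.
have cup : {within `[0, l], continuous (u * p)} := within_mulr cu cp.
have mono x y : 0 <= x -> x <= y -> y <= l -> u x * p x <= u y * p y.
  move=> x0; rewrite le_eqVlt => /predU1P[-> //|xy] yl.
  have sub z : z \in `]x, y[ -> z \in `]0, l[.
    rewrite !in_itv /= => /andP[xz zy].
    by rewrite (le_lt_trans x0 xz) (lt_le_trans zy yl).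
  have dxy z : z \in `]x, y[ -> is_derive z 1 (u * p) (p z ^+ 2 - m * u z ^+ 2).
    by move=> /sub; exact: dup.
  have cxy : {within `[x, y], continuous (u * p)}.
    apply: continuous_subspaceW cup => z /=; rewrite !in_itv /= => /andP[xz zy].
    by rewrite (le_trans x0 xz) (le_trans zy yl).
  have [z zE] := MVT xy dxy cxy.
  rewrite !fctE => /eqP; rewrite subr_eq => /eqP ->.
  by rewrite lerDr mulr_ge0 ?pos // subr_ge0 ltW.
split=> [|E x xl]; first by apply: mono => //; exact: ltW.
have cst y : y \in `[0, l] -> (u * p) y = u 0 * p 0.
  rewrite in_itv /= => /andP[y0 yl]; apply/eqP; rewrite eq_le; apply/andP; split.
    by rewrite -E; exact: (mono y l).
  exact: (mono 0 y).
suff du0 y : y \in `]0, l[ -> is_derive y 1 u 0 by exact: derive0_constant cu du0 xl.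
move=> yl; suff p0 : p y = 0 by rewrite -p0; exact: du.
have d0 : is_derive y 1 (u * p) 0.
  have near_cst : \forall z \near y, u 0 * p 0 = (u * p) z.
    near=> z; rewrite cst //; apply: itv_cc_sub.
    by near: z; exact: near_in_itvoo.
  exact: near_eq_is_derive near_cst (is_derive_cst (u 0 * p 0) y 1).
have E0 : p y ^+ 2 - m * u y ^+ 2 = 0.
  by rewrite -(@derive_val _ _ _ _ _ _ _ (dup y yl)) (@derive_val _ _ _ _ _ _ _ d0).
have := sqr_ge0 (p y); have := mulr_le0_ge0 m0 (sqr_ge0 (u y)) => h1 h2.
by apply/eqP; rewrite -sqrf_eq0; apply/eqP; lra.
Unshelve. all: by end_near. Qed.

End OneEdge.

(** * Eigenspaces *)

Section Eigenspace.
Context {R : realType} (G : metric_graph R).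
Local Notation V := (vertex G).
Local Notation E := (edge G).
Local Notation C := R[i].
Implicit Types (f p : graph_fun G) (e : E) (v : V).

Lemma ReD (a b : C) : complex.Re (a + b) = complex.Re a + complex.Re b.
Proof. by case: a b => [? ?] [? ?]. Qed.

Lemma ImD (a b : C) : complex.Im (a + b) = complex.Im a + complex.Im b.
Proof. by case: a b => [? ?] [? ?]. Qed.

Lemma ReN (a : C) : complex.Re (- a) = - complex.Re a.
Proof. by case: a. Qed.

Lemma ImN (a : C) : complex.Im (- a) = - complex.Im a.
Proof. by case: a. Qed.

Lemma ReM_real (a : C) (x : R) : complex.Re (a * x%:C) = complex.Re a * x.
Proof. by case: a => a b /=; rewrite mulr0 subr0. Qed.

Lemma ImM_real (a : C) (x : R) : complex.Im (a * x%:C) = complex.Im a * x.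
Proof. by case: a => a b /=; rewrite mulr0 add0r. Qed.

Lemma Re_sum (I : finType) (P : pred I) (F : I -> C) :
  complex.Re (\sum_(i | P i) F i) = \sum_(i | P i) complex.Re (F i).
Proof. exact: (big_morph _ ReD). Qed.

Lemma Im_sum (I : finType) (P : pred I) (F : I -> C) :
  complex.Im (\sum_(i | P i) F i) = \sum_(i | P i) complex.Im (F i).
Proof. exact: (big_morph _ ImD). Qed.

Lemma complex_ext (a b : C) : complex.Re a = complex.Re b ->
  complex.Im a = complex.Im b -> a = b.
Proof. by case: a b => [? ?] [? ?] /= -> ->. Qed.

Lemma H1_deriv_eigen (l m : R) (u q : R -> C) :
  H1_deriv l u q /\ H1_deriv l q (fun x => - (m%:C * u x)) <->
  H1_eigen l m (fun x => complex.Re (u x)) (fun x => complex.Re (q x)) /\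
  H1_eigen l m (fun x => complex.Im (u x)) (fun x => complex.Im (q x)).
Proof.
rewrite /H1_deriv /H1_eigen.
have -> : (fun x => complex.Re (- (m%:C * u x))) = (fun x => - (m * complex.Re (u x))).
  by apply/funext => x; rewrite ReN mulrC ReM_real mulrC.
have -> : (fun x => complex.Im (- (m%:C * u x))) = (fun x => - (m * complex.Im (u x))).
  by apply/funext => x; rewrite ImN mulrC ImM_real mulrC.
by split=> [[[? ?] [? ?]]|[[? ?] [? ?]]].
Qed.

Lemma sum_at_ends (a : V -> R) (b c : E -> R) :
  \sum_e (a (tgt e) * b e - a (src e) * c e) =
  \sum_v a v * (\sum_(e | tgt e == v) b e + \sum_(e | src e == v) - c e).
Proof.
under [RHS]eq_bigr => v _ do rewrite mulrDr !mulr_sumr.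
rewrite [RHS]big_split /=.
rewrite (exchange_big_dep predT) //= [X in _ = _ + X](exchange_big_dep predT) //=.
rewrite -big_split /=; apply: eq_bigr => e _.
by rewrite (big_pred1 (tgt e)) ?(big_pred1 (src e)) ?mulrN // => v; rewrite /= eq_sym.
Qed.

(** The increments of [u q] along the edges are nonnegative, and their sum, regrouped by vertices,
    vanishes by the Dirichlet and Kirchhoff conditions. So [u] is constant on every edge and, by
    connectedness, equal to its value at a leaf. *)
Lemma nonpositive_eigen_eq0 (m : R) (u q : E -> R -> R) (a : V -> R) :
  m <= 0 -> (exists r, @leaf R G r) ->
  (forall e, H1_eigen (len e) m (u e) (q e)) ->
  (forall e, u e 0 = a (src e) /\ u e (len e) = a (tgt e)) ->
  (forall v, leaf v -> a v = 0) ->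
  (forall v, ~~ leaf v ->
    \sum_(e | tgt e == v) q e (len e) + \sum_(e | src e == v) - q e 0 = 0) ->
  forall e x, x \in `[0, len e] -> u e x = 0.
Proof.
move=> m0 [r rleaf] uq ua a0 kirch.
have energy e := H1_eigen_energy (len_gt0 e) m0 (uq e).
have sum0 : \sum_e (u e (len e) * q e (len e) - u e 0 * q e 0) = 0.
  transitivity (\sum_e (a (tgt e) * q e (len e) - a (src e) * q e 0)).
    by apply: eq_bigr => e _; have [-> ->] := ua e.
  rewrite sum_at_ends big1 // => v _.
  by have [/a0 ->|/kirch ->] := boolP (leaf v); rewrite ?mul0r ?mulr0.
have cst e x : x \in `[0, len e] -> u e x = u e 0.
  apply: (energy e).2; apply/eqP; rewrite -subr_eq0; apply/eqP.
  move: sum0 => /eqP; rewrite psumr_eq0 => [/allP all0|e' _].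
    by have := all0 e (mem_index_enum e) => /eqP.
  by rewrite subr_ge0; have [] := energy e'.
have same e : a (src e) = a (tgt e).
  have [<- <-] := ua e; rewrite [RHS]cst // in_itv /= lexx andbT.
  exact/ltW/len_gt0.
have all0 v : a v = 0.
  have := graph_connected r v; set g := SimplRel _ => rv.
  have clos : fingraph.closed g [pred z | a z == 0].
    by move=> y z /existsP[e /orP[]/andP[/eqP <- /eqP <-]]; rewrite !inE same.
  have := closed_connect clos rv; rewrite !inE (a0 _ rleaf) eqxx.
  by move=> /esym/eqP.
by move=> e x /cst ->; have [-> _] := ua e.
Qed.

Lemma nonpositive_eigenspace (m : R) f : m <= 0 -> (exists r, @leaf R G r) ->
  eigenspace_at m f -> eq_on_graph f (fun _ _ => 0).
Proof.
move=> m0 rleaf [p [val [fp pf fval val0 kirch]]] e x xe.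
have eig e' := (H1_deriv_eigen (len e') m (f e') (p e')).1 (conj (fp e') (pf e')).
apply: complex_ext.
  apply: (nonpositive_eigen_eq0 (a := fun v => complex.Re (val v))
     (q := fun e x => complex.Re (p e x)) (u := fun e x => complex.Re (f e x))
     m0 rleaf) xe.
  - by move=> e'; have [] := eig e'.
  - by move=> e'; have [-> ->] := fval e'.
  - by move=> v /val0 ->.
  - move=> v /kirch /(congr1 (@complex.Re R)); rewrite ReD !Re_sum => k0.
    rewrite -[RHS]k0.
    by under [X in _ = _ + X]eq_bigr do rewrite ReN.
apply: (nonpositive_eigen_eq0 (a := fun v => complex.Im (val v))
   (q := fun e x => complex.Im (p e x)) (u := fun e x => complex.Im (f e x))
   m0 rleaf) xe.
- by move=> e'; have [] := eig e'.
- by move=> e'; have [-> ->] := fval e'.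
- by move=> v /val0 ->.
- move=> v /kirch /(congr1 (@complex.Im R)); rewrite ImD !Im_sum => k0.
  rewrite -[RHS]k0.
  by under [X in _ = _ + X]eq_bigr do rewrite ImN.
Qed.

Lemma built_cases (r v : V) (l : seq (V * V * E)) : v \in built r l ->
  v = r \/ exists2 x, x \in l & v = x.1.1.
Proof.
elim: l => [|x l ih] /=; first by rewrite mem_seq1 => /eqP; left.
rewrite inE => /predU1P[->|/ih[|[y yl vy]]]; [|by left|].
  by right; exists x; rewrite ?mem_head.
by right; exists y; rewrite // inE yl orbT.
Qed.

Definition on_graph (t : E * R) : Prop := t.2 \in `[0, len t.1].

Lemma has_dimension_hasdim (S : set (graph_fun G)) n : has_dimension S n ->
  hasdim on_graph (fun f : E * R -> C => S (fun e x => f (e, x))) n.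
Proof.
move=> [b [bS bI bG]]; exists (fun i t => b i t.1 t.2); split=> //.
- by move=> c c0; apply: bI => e x xe; exact: (c0 (e, x)).
- move=> f Sf; have [c fE] := bG _ Sf; exists c => -[e x] xe.
  exact: fE.
Qed.

Lemma has_dimension_eq0 (S : set (graph_fun G)) n : has_dimension S n ->
  (forall f, S f -> eq_on_graph f (fun _ _ => 0)) -> n = 0%N.
Proof.
move=> /has_dimension_hasdim Sn S0; apply: hasdim_unique Sn _.
by apply: hasdim_zero => f /S0 f0 [e x] xe; exact: f0.
Qed.

Definition initial_phase v : R := if leaf v then - (pi / 2) else 0.

Lemma kirchhoff_inflow (s : R) (val : V -> C) (q : E -> C) v :
  \sum_(e | tgt e == v) edge_slope s val q e (len e) + \sum_(e | src e == v) - q e =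
  \sum_e inflow s val q e v.
Proof. by rewrite big_mkcond [X in _ + X]big_mkcond -big_split. Qed.

(** Eigenfunctions correspond to coefficient vectors: at an inner vertex, of phase 0, the
    coefficient is the value; at a leaf, of phase [- pi / 2], it is the external flux needed for
    balance. Every vertex thus carries an equation of the same kind. *)
Lemma eigenspace_dimension (s : R) (r : V) l : 0 < s -> leaf r ->
  well_built r l -> joined l -> (forall v, v \in built r l) ->
  perm_eq [seq x.2 | x <- l] (index_enum E) ->
  hasdim on_graph (fun f : E * R -> C => eigenspace_at (s ^+ 2) (fun e x => f (e, x)))
    (collisions (@len R G) s l initial_phase).
Proof.
move=> s0 rleaf wl jl Vl El.
have sC0 : (s%:C : C) != 0 by rewrite fmorph_eq0 gt_eqF.
have inl e : exists2 x, x \in l & e = x.2.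
  have := perm_mem El e; rewrite mem_index_enum => /mapP[x xl ex].
  by exists x.
pose value (a : V -> C) v := a v * cosC (initial_phase v).
pose flux (a : V -> C) v := - (a v * sinC (initial_phase v)).
have phase_leaf v : leaf v -> cosC (initial_phase v) = 0 /\ sinC (initial_phase v) = -1.
  by move=> lv; rewrite /initial_phase lv /cosC /sinC cos_edge sin_edge rmorphN rmorph1.
have phase_inner v : ~~ leaf v -> cosC (initial_phase v) = 1 /\ sinC (initial_phase v) = 0.
  by move=> /negPf lv; rewrite /initial_phase lv /cosC /sinC cos0 sin0 rmorph0 rmorph1.
have sum_inflow val q z : \sum_(x <- l) inflow s val q x.2 z = \sum_e inflow s val q e z.
  by rewrite -(perm_big _ El) /= big_map.
pose F (a : V -> C) (t : E * R) : C :=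
  edge_value s (value a) (slope s l (value a) (flux a)) t.1 t.2.
have root0 : cos (initial_phase r) = 0 by rewrite /initial_phase rleaf cos_edge.
apply: (hasdim_iso (F := F)) (hasdim_sols (@len R G) s wl root0).
- move=> n c b [e x]; rewrite /F /edge_value /=.
  have vE : value (lincomb c b) = lincomb c (fun i => value (b i)).
    apply/funext => v; rewrite /value /lincomb mulr_suml.
    by apply: eq_bigr => i _; rewrite mulrA.
  have wE : flux (lincomb c b) = lincomb c (fun i => flux (b i)).
    apply/funext => v; rewrite /flux /lincomb mulr_suml -sumrN.
    by apply: eq_bigr => i _; ring.
  rewrite vE wE slope_lincomb /lincomb !mulr_suml -big_split /=.
  by apply: eq_bigr => i _; ring.
- move=> a [_ aK]; set q := slope s l (value a) (flux a).
  have [eE bE] : balanced r s l (value a) (flux a) q by apply/balancedE.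
  exists (fun e x => s%:C * edge_slope s (value a) q e x), (value a).
  have eig e : H1_deriv (len e) (fun x => F a (e, x))
        (fun x => s%:C * edge_slope s (value a) q e x) /\
      H1_deriv (len e) (fun x => s%:C * edge_slope s (value a) q e x)
        (fun x => - ((s ^+ 2)%:C * F a (e, x))).
    apply/H1_deriv_eigen; rewrite /F /edge_value /edge_slope /=; split.
      have := trig_H1_eigen s (complex.Re (value a (src e))) (complex.Re (q e)) (len_gt0 e).
      congr H1_eigen; apply/funext => x; rewrite ?[_%:C * _]mulrC ?ReM_real ?ReD ?ReN !ReM_real //.
      by rewrite mulrC.
    have := trig_H1_eigen s (complex.Im (value a (src e))) (complex.Im (q e)) (len_gt0 e).
    congr H1_eigen; apply/funext => x; rewrite ?[_%:C * _]mulrC ?ImM_real ?ImD ?ImN !ImM_real //.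
    by rewrite mulrC.
  split.
  + by move=> e; have [] := eig e.
  + by move=> e; have [] := eig e.
  + move=> e; have [x xl ex] := inl e; split; last by rewrite ex; exact: eE.
    by rewrite /F /edge_value /= mulr0 /cosC /sinC cos0 sin0 rmorph0 rmorph1 mulr1 mulr0 addr0.
  + by move=> v lv; rewrite /value; have [-> _] := phase_leaf v lv; rewrite mulr0.
  + move=> v lv; have := bE v (Vl v); rewrite sum_inflow -kirchhoff_inflow.
    rewrite /flux; have [_ ->] := phase_inner v lv; rewrite mulr0 oppr0 add0r => b0.
    rewrite /kirchhoff_at -[RHS](mulr0 s%:C) -[X in _ = _ * X]b0 mulrDr !mulr_sumr.
    congr (_ + _).
    apply: eq_bigr => e _; rewrite /edge_slope mulr0 /cosC /sinC cos0 sin0.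
    by rewrite rmorph0 rmorph1; ring.
- move=> n c b bS F0 v _; set a := lincomb c b.
  have aK : compat r (@len R G) s l (value a) (flux a).
    have := @compat_lincomb R G r s l n c (fun i => value (b i)) (fun i => flux (b i)).
    rewrite (_ : lincomb c (fun i => value (b i)) = value a); last first.
      apply/funext => w; rewrite /value /a /lincomb mulr_suml.
      by apply: eq_bigr => i _; rewrite mulrA.
    rewrite (_ : lincomb c (fun i => flux (b i)) = flux a); last first.
      apply/funext => w; rewrite /flux /a /lincomb mulr_suml -sumrN.
      by apply: eq_bigr => i _; ring.
    by apply=> i; have [] := bS i.
  set q := slope s l (value a) (flux a).
  have [eE bE] : balanced r s l (value a) (flux a) q by apply/balancedE.
  have src0 e : value a (src e) = 0.
    have : on_graph (e, 0) by rewrite /on_graph in_itv /= lexx ltW // len_gt0.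
    move=> /F0; rewrite -/a /F /edge_value /= mulr0 /cosC /sinC cos0 sin0.
    by rewrite rmorph0 rmorph1 mulr1 mulr0 addr0.
  have q0 e : q e = 0.
    (* At this point [s x] lies in []0, pi / 2]], where the sine does not vanish. *)
    pose x := Num.min (len e) (pi / (s + s)).
    have x0 : 0 < x by rewrite lt_min len_gt0 divr_gt0 ?pi_gt0 // addr_gt0.
    have : on_graph (e, x) by rewrite /on_graph in_itv /= (ltW x0) ge_min lexx.
    move=> /F0; rewrite -/a /F /edge_value /= src0 mul0r add0r -/q => /eqP.
    rewrite mulf_eq0 => /orP[/eqP //|]; rewrite fmorph_eq0 gt_eqF // sin_gt0_pi //.
    rewrite mulr_gt0 //=; apply: le_lt_trans (_ : pi / 2 < pi); last first.
      by have := pi_gt0 R; lra.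
    have : x <= pi / (s + s) by rewrite ge_min lexx orbT.
    rewrite -(ler_pM2l s0) => /le_trans; apply.
    by rewrite le_eqVlt; apply/orP; left; apply/eqP; field; rewrite gt_eqF //; lra.
  have val0 w : value a w = 0.
    have [lw|nlw] := boolP (leaf w).
      by rewrite /value; have [-> _] := phase_leaf w lw; rewrite mulr0.
    have [wr|[x xl wx]] := built_cases (Vl w); first by rewrite wr rleaf in nlw.
    have := allP jl x xl; rewrite -wx => /orP[/andP[/eqP <- _] //|/andP[_ /eqP wt]].
    by have := eE x xl; rewrite wt /edge_value src0 q0 !mul0r addr0.
  have flux0 w : flux a w = 0.
    have := bE w (Vl w); rewrite big1 ?addr0 // => x _.
    by rewrite /inflow /edge_slope !q0 !src0 !mul0r subrr oppr0 !if_same addr0.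
  have [lv|lv] := boolP (leaf v).
    have := flux0 v; rewrite /flux; have [_ ->] := phase_leaf v lv.
    by rewrite mulrN1 opprK.
  have := val0 v; rewrite /value; have [-> _] := phase_inner v lv.
  by rewrite mulr1.
- move=> f [p [val [fp pf fval val0 kirch]]].
  have eig e := (H1_deriv_eigen (len e) _ _ (p e)).1 (conj (fp e) (pf e)).
  pose q e := p e 0 / s%:C.
  have fE e x : x \in `[0, len e] -> f (e, x) = edge_value s val q e x /\
      p e x = s%:C * edge_slope s val q e x.
    move=> xe; have [eR eI] := eig e.
    have [r1 r2] := H1_eigen_trig (len_gt0 e) (lt0r_neq0 s0) eR xe.
    have [i1 i2] := H1_eigen_trig (len_gt0 e) (lt0r_neq0 s0) eI xe.
    have [f0 _] := fval e.
    have qE : q e = p e 0 * (s^-1)%:C by rewrite /q fmorphV.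
    rewrite /edge_value /edge_slope -f0; split; apply: complex_ext.
    + by rewrite r1 ReD !ReM_real qE ReM_real.
    + by rewrite i1 ImD !ImM_real qE ImM_real.
    + by rewrite r2 [s%:C * _]mulrC ReM_real ReD ReN !ReM_real qE ReM_real [RHS]mulrC.
    + by rewrite i2 [s%:C * _]mulrC ImM_real ImD ImN !ImM_real qE ImM_real [RHS]mulrC.
  pose ext v := - \sum_e inflow s val q e v.
  pose a v := if leaf v then ext v else val v.
  have vE : value a = val.
    apply/funext => v; rewrite /value /a; have [lv|lv] := boolP (leaf v).
      by have [-> _] := phase_leaf v lv; rewrite mulr0 val0.
    by have [-> _] := phase_inner v lv; rewrite mulr1.
  have len_in e : len e \in `[0, len e] by rewrite in_itv /= lexx andbT ltW // len_gt0.
  have wE : flux a = ext.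
    apply/funext => v; rewrite /flux /a; have [lv|lv] := boolP (leaf v).
      by have [_ ->] := phase_leaf v lv; rewrite mulrN1 opprK.
    have [_ ->] := phase_inner v lv; rewrite mulr0 oppr0 /ext -kirchhoff_inflow.
    apply/esym/eqP; rewrite oppr_eq0 -(mulrI_eq0 _ (lregP sC0)) mulrDr !mulr_sumr.
    apply/eqP; rewrite -[RHS](kirch v lv); congr (_ + _); apply: eq_bigr => e _.
      by have [_ <-] := fE e _ (len_in e).
    by rewrite /q mulrN mulrC divfK.
  have bal : balanced r s l val ext q.
    split=> [x _|z _]; last by rewrite sum_inflow /ext addNr.
    by have [<- _] := fE x.2 _ (len_in x.2); have [_ ->] := fval x.2.
  have [aK qE] := (balancedE s val ext q wl jl).1 bal.
  exists a; first by split=> [z|]; [rewrite Vl|rewrite -/(value a) -/(flux a) vE wE].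
  move=> [e x] xe; rewrite (fE e x xe).1 /F vE wE /edge_value /=.
  by have [y yl ->] := inl e; rewrite qE.
- by move=> f g fg; have -> : f = g by apply/funext => v; exact: fg.
Qed.

End Eigenspace.

(** * Counting *)

Section Counting.
Local Open Scope card_scope.

Lemma card_upper_segment (S : set nat) (m d : nat) : S #= `I_d ->
  (forall k, S k -> (m < k)%N) ->
  (forall j k, (m < j <= k)%N -> S k -> S j) ->
  forall k, S k <-> (m < k <= m + d)%N.
Proof.
move=> Sd Sm Sdown.
have shift n : [set (m.+1 + i)%N | i in `I_n] #= `I_n.
  by apply: inj_card_eq => i j _ _ /addnI.
move=> k; split=> [Sk|/andP[mk kmd]].
  rewrite Sm //= leqNgt; apply/negP => lt.
  have : [set (m.+1 + i)%N | i in `I_d.+1] #<= S.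
    apply: subset_card_le => _ [i /= id <-]; apply: Sdown Sk.
    by apply/andP; split; lia.
  by rewrite (card_le_eql (shift _)) (card_le_eqr Sd) card_le_II ltnn.
apply: contrapT => nSk.
have : S #<= [set (m.+1 + i)%N | i in `I_(k - m.+1)].
  apply: subset_card_le => j Sj; have mj := Sm _ Sj.
  have jk : (j < k)%N.
    rewrite ltnNge; apply/negP => kj; apply: nSk; apply: Sdown Sj.
    by rewrite mk.
  by exists (j - m.+1)%N => /=; lia.
rewrite (card_le_eqr (shift _)) (card_le_eql Sd) card_le_II; lia.
Qed.

(* [N s] counts the terms [<= s ^+ 2] of the sequence; [M] is its left limit. *)
Lemma counting_function {R : realType} (lam : nat -> R) (N M : R -> nat) :
  N 0 = 0%N ->
  (forall s, 0 < s -> (M s <= N s)%N) ->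
  (forall u s, 0 <= u -> u < s -> (N u <= M s)%N) ->
  (forall s, 0 <= s -> exists2 u, s < u & N u = N s) ->
  (forall s, 0 < s -> exists u, [/\ 0 <= u, u < s & N u = M s]) ->
  (forall j k : nat, (1 <= j <= k)%N -> lam j <= lam k) ->
  (forall k, (1 <= k)%N -> 0 < lam k) ->
  (forall s, 0 < s -> [set k : nat | (1 <= k)%N /\ lam k = s ^+ 2] #= `I_(N s - M s)) ->
  forall s k, 0 <= s -> (1 <= k)%N -> (lam k <= s ^+ 2) = (k <= N s)%N.
Proof.
move=> N0 MN NM Nright Nleft lam_mono lam_gt0 lam_card.
have Nmono u s : 0 <= u -> u <= s -> (N u <= N s)%N.
  move=> u0; rewrite le_eqVlt => /predU1P[-> //|us].
  by rewrite (leq_trans (NM _ _ u0 us)) // MN // (le_lt_trans u0).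
have none s k : 0 < s -> M s = N s -> (1 <= k)%N -> lam k <> s ^+ 2.
  move=> s0 e k1 ks; have := lam_card _ s0; rewrite e subnn II0 card_eq0 => /eqP.
  by move=> /seteqP[/(_ k) /=]; case.
have sq k : (1 <= k)%N -> exists2 u, 0 < u & lam k = u ^+ 2.
  move=> /lam_gt0 k0; exists (Num.sqrt (lam k)); first by rewrite sqrtr_gt0.
  by rewrite sqr_sqrtr // ltW.
have sqle (u s : R) : 0 <= u -> 0 <= s -> (u ^+ 2 <= s ^+ 2) = (u <= s).
  by move=> *; rewrite ler_sqr.
(* Induction on a bound for [N s]: the count at [s] is traced back to the last jump [t <= s], to the
   left of which it is smaller. *)
move=> s k s0 k1; move: {2}(N s) (leqnn (N s)) => n.
elim: n s k s0 k1 => [|n ih] s k s0 k1 Ns.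
  have -> : N s = 0%N by apply/eqP; rewrite -leqn0.
  rewrite leqNgt k1; apply/negP => ks; have [u u0 ku] := sq _ k1.
  rewrite ku sqle // in ks; last exact: ltW.
  have Nu : N u = 0%N by apply/eqP; rewrite -leqn0 (leq_trans _ Ns) // Nmono // ltW.
  apply: (none u k) => //; rewrite Nu.
  by apply/eqP; rewrite -leqn0 -Nu MN.
pose A : set R := [set u | 0 <= u <= s /\ N u = N s].
have A0 : A !=set0 by exists s; rewrite /A /= s0 lexx.
have lbA : lbound A 0 by move=> u [/andP[]].
pose t := inf A.
have t0 : 0 <= t by apply: lb_le_inf.
have ts : t <= s by apply: ge_inf; [exists 0|rewrite /A /= s0 lexx].
have Nt : N t = N s.
  (* Right continuity makes the infimum [t] of the points with the count of [s] have this count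
     itself. *)
  have [u tu uE] := Nright _ t0.
  have ut0 : 0 < u - t by rewrite subr_gt0.
  have hA : has_inf A by split=> //; exists 0.
  have [a [/andP[a0 as_] aE] au] := inf_adherent ut0 hA.
  rewrite -/t addrC subrK in au; apply/eqP; rewrite eqn_leq Nmono //=.
  by rewrite -aE -uE Nmono // ltW.
have tmin u : 0 <= u -> u <= s -> N u = N s -> t <= u.
  by move=> u0 us uE; apply: ge_inf; [exists 0|rewrite /A /= u0 us].
have high v j : t < v -> v <= s -> (1 <= j)%N -> lam j <> v ^+ 2.
  move=> tv vs; have v0 : 0 < v := le_lt_trans t0 tv.
  apply: none => //; apply/eqP; rewrite eqn_leq MN //=.
  by rewrite (leq_trans (Nmono _ _ (ltW v0) vs)) // -Nt NM.
have [tE|{}t0] : t = 0 \/ 0 < t by move: t0; rewrite le_eqVlt => /predU1P[]; auto.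
  have Ns0 : N s = 0%N by rewrite -Nt tE.
  rewrite Ns0 leqNgt k1; apply/negP => ks; have [v v0 kv] := sq _ k1.
  rewrite kv sqle // in ks; last exact: ltW.
  by apply: (high v k) => //; rewrite tE.
(* [u] is so close to [t] that no term lies strictly between [u ^+ 2] and [t ^+ 2]; the induction
   hypothesis at [u] handles the [M t] terms before the jump. *)
have [u [u0 ut uM]] := Nleft _ t0.
have us : u <= s by rewrite ltW // (lt_le_trans ut).
have Nus : (N u < N s)%N.
  rewrite ltn_neqAle Nmono // andbT; apply/eqP => e.
  by have := tmin u u0 us e; rewrite leNgt ut.
have low v j : u < v -> v < t -> (1 <= j)%N -> lam j <> v ^+ 2.
  move=> uv vt; have v0 : 0 < v := le_lt_trans u0 uv.
  apply: none => //; apply/eqP; rewrite eqn_leq MN //=.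
  by rewrite (@leq_trans (M t)) ?NM ?(ltW v0) // -uM NM.
have IH j : (1 <= j)%N -> (lam j <= u ^+ 2) = (j <= M t)%N.
  by move=> j1; rewrite ih // ?uM // -ltnS (leq_trans _ Ns) // -uM.
have seg := @card_upper_segment _ (M t) _ (lam_card _ t0).
have {}seg : forall j, (1 <= j)%N /\ lam j = t ^+ 2 <-> (M t < j <= M t + (N t - M t))%N.
  apply: seg => [j [j1 jt]|i j /andP[Mi ij] [j1 jt]].
    by rewrite ltnNge -IH // jt (sqle _ _ (ltW t0) u0) -ltNge.
  have i1 : (1 <= i)%N by exact: leq_ltn_trans Mi.
  split=> //; have [v v0 iv] := sq _ i1; rewrite iv.
  have vt : v <= t by rewrite -(sqle _ _ (ltW v0) (ltW t0)) -iv -jt lam_mono // i1.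
  have uv : u < v by rewrite ltNge -(sqle _ _ (ltW v0) u0) -iv IH // -ltnNge.
  by move: vt; rewrite le_eqVlt => /predU1P[-> //|/(low _ _ uv) /(_ i1)].
rewrite subnKC ?MN // in seg; rewrite -Nt.
apply/idP/idP => [ks|kN].
  have [kM|kM] := leqP k (M t); first by rewrite (leq_trans kM) // MN.
  have [v v0 kv] := sq _ k1.
  have uv : u < v by rewrite ltNge -(sqle _ _ (ltW v0) u0) -kv IH // -ltnNge.
  rewrite kv sqle // in ks; last exact: ltW.
  have [vt|tv|vt] := ltgtP v t.
  - by case: (low v k).
  - by case: (high v k).
  - by have /seg/andP[] : (1 <= k)%N /\ lam k = t ^+ 2 by rewrite kv vt.
have [kM|kM] := leqP k (M t).
  by move: kM; rewrite -IH // => /le_trans; apply; rewrite sqle.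
have /seg[_ ->] : (M t < k <= N t)%N by rewrite kM.
by rewrite (sqle _ _ (ltW t0) s0).
Qed.

Lemma counting_double {R : realType} (lam : nat -> R) (N : R -> nat) :
  (forall k, (1 <= k)%N -> 0 < lam k) ->
  (forall s k, 0 <= s -> (1 <= k)%N -> (lam k <= s ^+ 2) = (k <= N s)%N) ->
  (forall s, 0 <= s -> (2 * N s <= N (2 * s)%R)%N) ->
  forall k, (1 <= k)%N -> lam (2 * k)%N / lam k <= 4.
Proof.
move=> lam0 lamN N2 k k1; have k0 := lam0 _ k1; rewrite ler_pdivrMr //.
pose s := Num.sqrt (lam k); have s0 : 0 <= s by exact: sqrtr_ge0.
have ks : lam k = s ^+ 2 by rewrite sqr_sqrtr // ltW.
have -> : 4 * lam k = (2 * s) ^+ 2 by rewrite ks; ring.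
rewrite lamN; [|by rewrite mulr_ge0|lia].
apply: leq_trans (N2 _ s0).
by rewrite leq_mul2l /= -lamN // ks.
Qed.

End Counting.

Theorem theorem1p4 (R : realType) (G : metric_graph R) (lam : nat -> R)
    (tree_G : is_tree G) (lam_spectrum : is_dirichlet_spectrum G lam)
    (k : nat) (k_ge1 : (1 <= k)%N) :
  lam (2 * k)%N / lam k <= 4.
Proof.
have [lam_mono spec] := lam_spectrum.
have nonzero j : (1 <= j)%N ->
    ~ (forall f, @eigenspace_at R G (lam j) f -> eq_on_graph f (fun _ _ => 0)).
  move=> j1 E0; have [n [dimE card]] := spec (lam j).
  move: card; rewrite (has_dimension_eq0 dimE E0) II0 card_eq0 => /eqP.
  by move=> /seteqP[/(_ j) /=]; case.
(* Without edges every eigenspace is zero, whereas [lam 1] must have a nonzero one. *)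
have [E0|E_gt0] := posnP #|edge G|.
  by case: (nonzero 1%N) => // f _ e; have := card0_eq E0 e; rewrite inE.
have leafG := tree_has_leaf tree_G E_gt0; have [r rleaf] := leafG.
have [l [wl jl Vl El]] := tree_decomposition r tree_G.
have inl e : e \in [seq x.2 | x <- l] by rewrite (perm_mem El) mem_index_enum.
pose th := @initial_phase R G.
pose T s := root_phase r (@len R G) merge s l th.
pose T' s := root_phase r (@len R G) merge_lower s l th.
have [T'T TT' Tright T'left] : phase_pair T T'.
  apply: (@root_phase_pair _ _ r R (@len R G) l (fun v _ => th v) (fun v _ => th v)).
    exact: len_gt0.
  by move=> v; exact: phase_pair_cst.
have p0 := pi_gt0 R.
have [T0 T2] : superhomogeneous T.
  apply: (@root_phase_super _ _ r R (@len R G) l _ (fun v _ => th v)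
    (active_leaf wl jl inl)) => // v.
    by move=> lv; rewrite /th /initial_phase lv; split=> // s _; lra.
  by move=> /negPf lv; apply/funext => s; rewrite /th /initial_phase lv.
have /choice[n Tn] : forall s, exists n : int, T s = n%:~R * pi - pi / 2.
  by move=> s; apply: root_phase_edge; exists 0; rewrite /th /initial_phase rleaf; lra.
have T_ge s : 0 <= s -> - (pi / 2) <= T s.
  rewrite le_eqVlt => /predU1P[<-|s0]; first by rewrite T0.
  by rewrite -T0 (le_trans (TT' _ _ (lexx 0) s0)) // T'T // ltW.
pose N s := `|n s|%N; pose D s := collisions (@len R G) s l th.
pose M s := (N s - D s)%N.
have TN s : 0 <= s -> T s = (N s)%:R * pi - pi / 2.
  move=> s0; have nE : n s = (N s)%:Z.
    rewrite /N gez0_abs // -(ler_int R) -(ler_pM2r p0).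
    by have := T_ge _ s0; rewrite Tn; lra.
  by rewrite Tn nE.
have T'E s : T' s = T s - (D s)%:R * pi.
  rewrite /T' (@root_phase_gap _ _ r R (@len R G) s l th th (fun=> 0%N) wl); last first.
    by move=> v; rewrite mul0r subr0.
  by rewrite big1 // add0n.
have leN (a b : nat) : a%:R * pi - pi / 2 < b%:R * pi - pi / 2 + pi :> R -> (a <= b)%N.
  move=> ab; rewrite -ltnS -(ltr_nat R) -(ltr_pM2r p0).
  by rewrite -[b.+1%:R](natr1 b) mulrDl mul1r; lra.
have leN' (a b : nat) : a%:R * pi - pi / 2 <= b%:R * pi - pi / 2 :> R -> (a <= b)%N.
  by move=> ab; rewrite -(ler_nat R) -(ler_pM2r p0); lra.
have DN s : 0 < s -> (D s <= N s)%N.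
  move=> s0; apply: leN'; have := TT' _ _ (lexx 0) s0.
  by rewrite T0 T'E TN ?(ltW s0) //; lra.
have T'M s : 0 < s -> T' s = (M s)%:R * pi - pi / 2.
  by move=> s0; rewrite T'E TN ?(ltW s0) // /M natrB ?DN //; lra.
have lam_gt0 j : (1 <= j)%N -> 0 < lam j.
  move=> j1; rewrite ltNge; apply/negP => lj; apply: (nonzero j j1) => f.
  exact: nonpositive_eigenspace lj leafG.
apply: (@counting_double R lam N) => //.
- apply: (@counting_function R lam N M) => //.
  + by apply/eqP; rewrite -leqn0; apply: leN'; rewrite -TN // T0; lra.
  + by move=> s s0; exact: leq_subr.
  + move=> u s u0 us; have s0 := le_lt_trans u0 us; apply: leN'.
    by rewrite -TN // -T'M // TT'.
  (* [T] moves by multiples of [pi], so coming within less than [pi] of a one-sided limit means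
     having reached it. *)
  + move=> s s0; have [u [su Tu]] := Tright s pi s0 p0; exists u => //.
    have u0 : 0 < u := le_lt_trans s0 su.
    apply/eqP; rewrite eqn_leq; apply/andP; split.
      by apply: leN; rewrite -!TN // ltW.
    apply: leN'; rewrite -!TN ?(ltW u0) //.
    by rewrite (le_trans (TT' _ _ s0 su)) // T'T // ltW.
  + move=> s s0; have [u [u0 us T'u]] := T'left s pi s0 p0; exists u; split=> //.
    apply/eqP; rewrite eqn_leq; apply/andP; split.
      by apply: leN'; rewrite -TN // -T'M // TT'.
    apply: leN; rewrite -T'M // -TN //; have := T'T _ u0; lra.
  + move=> s s0; have [m [dimE card]] := spec (s ^+ 2).
    have -> : (N s - M s)%N = m.
      rewrite /M subKn ?DN //.
      apply: hasdim_unique (has_dimension_hasdim dimE).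
      exact: (eigenspace_dimension s0 rleaf wl jl Vl El).
    exact: card.
- move=> s s0; apply: leN'; rewrite -TN ?mulr_ge0 //.
  by have := T2 _ s0; rewrite (TN s) // natrM; lra.
Qed.
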